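(* Let $\Sigma$ be a surface of constant curvature (Euclidean plane, unit sphere or hyperbolic plane). Then each germ of $C^2$-smooth curve in $\Sigma$ (with non-zero geodesic curvature) having string Poritsky property is a conic, i.e. is a germ of curve contained in a conic of $\Sigma$.
   Context: Models: consider $\mathbb R^3$ with coordinates $(x_1,x_2,x_3)$, $\langle x,x\rangle=x_1^2+x_2^2+x_3^2$. The surfaces of constant curvature are: the Euclidean plane $\Sigma=\{x_3=1\}$, $Q=\operatorname{diag}(1,1,0)$; the unit sphere $\Sigma=\{x_1^2+x_2^2+x_3^2=1\}$, $Q=\mathrm{Id}$; the hyperbolic plane $\Sigma=\{x_1^2+x_2^2-x_3^2=-1\}\cap\{x_3>0\}$, $Q=\operatorname{diag}(1,1,-1)$. The metric on $\Sigma$ is induced by the quadratic form $\langle Qx,x\rangle$. Geodesics are intersections of $\Sigma$ with two-dimensional vector subspaces of $\mathbb R^3$. Conics on $\Sigma$ are intersections of $\Sigma$ with quadrics $\{\langle Cx,x\rangle=0\}$, where $C$ is a (non-zero) real symmetric $3\times3$ matrix. String Poritsky property: let $\gamma$ be a germ of oriented curve with non-zero geodesic curvature on a Riemannian surface. For $A,B\in\gamma$ close enough let $C_{AB}$ be the unique nearby intersection point of the geodesics tangent to $\gamma$ at $A$ and at $B$, $\lambda(A,B)$ the length of the arc $AB$ of $\gamma$, and $L(A,B)=|AC_{AB}|+|BC_{AB}|-\lambda(A,B)$, where $|XY|$ is the length of the small geodesic segment $XY$. The germ $\gamma$ has string Poritsky property if it admits a $C^1$-smooth parametrization by a parameter $t$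 (a $C^1$-smooth local coordinate on $\gamma$) such that for every $p>0$ small enough there exists $c_p>0$ such that for every pair $B,A\in\gamma$ ordered by orientation with $L(A,B)=p$ one has $t(A)-t(B)=c_p$. *)

(* Defs.v *)
(* Stdlib reals with Coquelicot. *)
From Stdlib Require Import Reals.
From Coquelicot Require Import Coquelicot.
Open Scope R_scope.

Notation vec := (R * R * R)%type.
Notation mat := (@matrix R 3 3).

Definition coord (x : vec) (i : nat) : R :=
  match i with
  | 0%nat => fst (fst x)
  | 1%nat => snd (fst x)
  | _ => snd x
  end.

(** [form M x y] is <Mx, y>; [sum_n u 2] is u 0 + u 1 + u 2. *)
Definition form (M : mat) (x y : vec) : R :=
  sum_n (fun i => sum_n (fun j => coeff_mat 0 M i j * coord x j) 2 * coord y i) 2.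

Definition diag (a b c : R) : mat :=
  mk_matrix 3 3 (fun i j => if Nat.eqb i j then coord (a, b, c) i else 0).

Definition symmetric (M : mat) : Prop :=
  forall i j, (i < 3)%nat -> (j < 3)%nat -> coeff_mat 0 M i j = coeff_mat 0 M j i.

Inductive geometry := Euclidean | Spherical | Hyperbolic.

Definition Q (g : geometry) : mat :=
  match g with
  | Euclidean => diag 1 1 0
  | Spherical => diag 1 1 1
  | Hyperbolic => diag 1 1 (-1)
  end.

Definition Sigma (g : geometry) (x : vec) : Prop :=
  let x1 := coord x 0 in let x2 := coord x 1 in let x3 := coord x 2 in
  match g with
  | Euclidean => x3 = 1
  | Spherical => x1 ^ 2 + x2 ^ 2 + x3 ^ 2 = 1
  | Hyperbolic => x1 ^ 2 + x2 ^ 2 - x3 ^ 2 = -1 /\ 0 < x3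
  end.

Definition conic (g : geometry) (C : mat) (x : vec) : Prop :=
  Sigma g x /\ form C x x = 0.

(** The geodesic cut out by the plane spanned by [u] and [v]
    (meant for linearly independent [u] and [v]). *)
Definition geodesic (g : geometry) (u v x : vec) : Prop :=
  Sigma g x /\ exists a b : R, x = plus (scal a u) (scal b v).

(** Derivative of a curve, coordinate by coordinate. *)
Definition velocity (c : R -> vec) (s : R) : vec :=
  (Derive (fun u => coord (c u) 0) s,
   Derive (fun u => coord (c u) 1) s,
   Derive (fun u => coord (c u) 2) s).

Definition curve_length (g : geometry) (c : R -> vec) (a b : R) : R :=
  RInt (fun s => sqrt (form (Q g) (velocity c s) (velocity c s))) a b.

(** Radial projection of the chord [X, Y] to the surface: for close [X] and [Y]
    on the surface it parametrizes by [0, 1] the small geodesic segment XY. *)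
Definition segment (g : geometry) (X Y : vec) (s : R) : vec :=
  let v := plus (scal (1 - s) X) (scal s Y) in
  match g with
  | Euclidean => v
  | Spherical => scal (/ sqrt (form (Q g) v v)) v
  | Hyperbolic => scal (/ sqrt (- form (Q g) v v)) v
  end.

Definition segment_length (g : geometry) (X Y : vec) : R :=
  curve_length g (segment g X Y) 0 1.

(** Levi-Civita derivative of the velocity along a curve in the surface: the
    tangential part of the second derivative.  In the curved cases the tangent
    plane at x is the [Q]-orthogonal complement of x; in the Euclidean plane the
    second derivative is already tangent. *)
Definition covariant_acceleration (g : geometry) (c : R -> vec) (s : R) : vec :=
  let w := velocity (velocity c) s in
  match g with
  | Euclidean => w
  | _ => minus w
           (scal (form (Q g) w (c s) / form (Q g) (c s) (c s)) (c s))
  end.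

(** Unsigned geodesic curvature for an arbitrary regular parametrization: the
    norm of the component of the covariant acceleration normal to the velocity,
    divided by the squared speed. *)
Definition geodesic_curvature (g : geometry) (c : R -> vec) (s : R) : R :=
  let v := velocity c s in
  let w := covariant_acceleration g c s in
  let n := minus w (scal (form (Q g) w v / form (Q g) v v) v) in
  sqrt (form (Q g) n n) / form (Q g) v v.

Definition Ck_near (k : nat) (f : R -> R) (s0 : R) : Prop :=
  locally s0 (fun s =>
    (forall j, (j <= k)%nat -> ex_derive_n f j s) /\ continuous (Derive_n f k) s).

(** A germ of regular C^2 curve in the surface, given by a parametrization near
    [s0] and oriented by increasing parameter. *)
Definition C2_curve_germ (g : geometry) (c : R -> vec) (s0 : R) : Prop :=
  (forall i, (i < 3)%nat -> Ck_near 2 (fun s => coord (c s) i) s0) /\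
  locally s0 (fun s => Sigma g (c s)) /\
  velocity c s0 <> zero.

(** [C] is a common point of the geodesics tangent to [c] at [c a] and [c b]. *)
Definition tangents_meet_at (g : geometry) (c : R -> vec) (a b : R) (C : vec) : Prop :=
  geodesic g (c a) (velocity c a) C /\ geodesic g (c b) (velocity c b) C.

(** L(A, B) for A = c a, B = c b with [b <= a], and C_AB = [C]. *)
Definition string_defect (g : geometry) (c : R -> vec) (a b : R) (C : vec) : R :=
  segment_length g (c a) C + segment_length g (c b) C - curve_length g c b a.

(** [t] is the local coordinate read in the parameter of the curve.  A single
    [delta] measures "close enough" for A, B and the nearby point C_AB, and
    "small enough" for p.  The condition is inherited by smaller [delta], so the
    existence of some [delta] is the same as validity for all small ones; for
    those, the point [C] in the ball is the unique nearby intersection point. *)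
Definition string_Poritsky (g : geometry) (c : R -> vec) (s0 : R) : Prop :=
  exists t : R -> R,
    Ck_near 1 t s0 /\ Derive t s0 <> 0 /\
    exists delta : posreal,
      forall p, 0 < p < delta ->
      exists cp, 0 < cp /\
        forall a b C,
          ball s0 delta a -> ball s0 delta b -> b < a ->
          ball (c s0) delta C -> tangents_meet_at g c a b C ->
          string_defect g c a b C = p ->
          t a - t b = cp.

(* Main.v *)
Require Import Defs.
From Stdlib Require Import Reals Lra Lia Psatz Ranalysis5 Classical.
From Coquelicot Require Import Coquelicot.
Open Scope R_scope.

(** Treat the three geometries together, with e = 0, 1, -1 the curvature.  Write
    n = c x c' for the covector of the tangent geodesic, u = |c'| and
    D = det (c, c', c'').  The first variation of L(a, b) gives
      dL/da = D(a) <c(a), n(b)> K / u(a),  dL/db = - D(b) <c(b), n(a)> K / u(b)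
    with the same K > 0.  Along a level curve of L the difference t(a) - t(b) is
    constant, so t'(a) dL/db + t'(b) dL/da = 0; that is, m = (t' u / D) n satisfies
    <m(a), c(b)> = <m(b), c(a)> for all a and b.  Taking for b three parameters
    whose points are linearly independent, m(a) is a linear function M of c(a).
    Since n is orthogonal to c, <M c, c> = 0, which is the equation of a conic. *)

(** * Bilinear algebra of the models *)

(** The curve is only C^2 and t only C^1, so D and m are in general merely continuous and no
    differential equation for m is available. This is why the proof stops at first derivatives of L
    and finishes by linear algebra. The level curve of L is not parametrized either: a pair (x, b)
    is compared with a pair (a, y) having the same L, so that each endpoint moves alone, only
    partial derivatives of L occur, and the intermediate value theorem provides x for a given y. The
    other obstacle is locality. The hypothesis speaks of small p and of intersection points near the
    base point, so the parameter interval is shrunk until the arc is convex uniformly in two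
    parameters, its tangents meet inside the prescribed ball, and every value of L on it is an
    admissible p. The conic is not degenerate to the zero form because t' does not vanish at the
    base point. *)

Definition dot (x y : vec) : R :=
  coord x 0 * coord y 0 + coord x 1 * coord y 1 + coord x 2 * coord y 2.

Definition cross (x y : vec) : vec :=
  (coord x 1 * coord y 2 - coord x 2 * coord y 1,
   coord x 2 * coord y 0 - coord x 0 * coord y 2,
   coord x 0 * coord y 1 - coord x 1 * coord y 0).

Definition curv (g : geometry) : R :=
  match g with Euclidean => 0 | Spherical => 1 | Hyperbolic => -1 end.

Definition metric (e : R) (x y : vec) : R :=
  coord x 0 * coord y 0 + coord x 1 * coord y 1 + e * (coord x 2 * coord y 2).

(** The adjugate form of [metric e]; it takes the value 1 on the surface. *)
Definition polar (e : R) (x y : vec) : R :=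
  e * (coord x 0 * coord y 0 + coord x 1 * coord y 1) + coord x 2 * coord y 2.

Ltac vec_simpl :=
  unfold metric, polar, dot, cross;
  repeat (unfold plus, scal, minus, opp, mult, zero; simpl).

Ltac real_ring := match goal with |- ?a = ?b => change (@eq R a b) end; ring.

Ltac vec_ring := vec_simpl; real_ring.

Lemma vec_ext (x y : vec) : (forall i, coord x i = coord y i) -> x = y.
Proof.
  intros H. destruct x as [[x1 x2] x3], y as [[y1 y2] y3].
  pose proof (H 0%nat). pose proof (H 1%nat). pose proof (H 2%nat).
  simpl in *. now subst.
Qed.

Ltac vec_eq := apply vec_ext; intros [|[|i]]; vec_ring.

Lemma sum_n_2 (u : nat -> R) : sum_n u 2 = u 0%nat + u 1%nat + u 2%nat.
Proof. rewrite !sum_Sn, sum_O. reflexivity. Qed.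

Lemma form_mk_matrix (m : nat -> nat -> R) (x y : vec) :
  form (mk_matrix 3 3 m) x y
  = dot (m 0%nat 0%nat, m 0%nat 1%nat, m 0%nat 2%nat) x * coord y 0
    + dot (m 1%nat 0%nat, m 1%nat 1%nat, m 1%nat 2%nat) x * coord y 1
    + dot (m 2%nat 0%nat, m 2%nat 1%nat, m 2%nat 2%nat) x * coord y 2.
Proof.
  unfold form. rewrite sum_n_2. cbv beta. rewrite !sum_n_2. cbv beta.
  rewrite !coeff_mat_bij by lia. reflexivity.
Qed.

Lemma form_Q (g : geometry) (x y : vec) : form (Q g) x y = metric (curv g) x y.
Proof.
  destruct g; unfold Q, diag; rewrite form_mk_matrix; vec_ring.
Qed.

Lemma Sigma_polar (g : geometry) (x : vec) :
  Sigma g x -> polar (curv g) x x = 1.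
Proof.
  destruct x as [[x1 x2] x3]; destruct g; unfold Sigma, polar; simpl; nra.
Qed.

Lemma curv_bounds (g : geometry) : -1 <= curv g <= 1.
Proof. destruct g; simpl; lra. Qed.

Lemma polar_tangent (g : geometry) (x v : vec) :
  Sigma g x -> polar (curv g) x v = 0 ->
  polar (curv g) v v = curv g * metric (curv g) v v.
Proof.
  destruct x as [[x1 x2] x3], v as [[v1 v2] v3].
  destruct g; unfold Sigma, polar, metric; simpl; intros H1 H2; try ring.
  subst x3. replace v3 with 0 by lra. ring.
Qed.

(** Lagrange's identity for [polar], the assertion [E], carries a factor e and says nothing in the
    Euclidean case, where v3 = 0 is used instead. Normals therefore have the length of the
    velocity. *)
Lemma metric_cross_tangent (g : geometry) (x v : vec) :
  Sigma g x -> polar (curv g) x v = 0 ->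
  metric (curv g) (cross x v) (cross x v) = metric (curv g) v v.
Proof.
  intros Hx Hv. pose proof (Sigma_polar g x Hx) as H1.
  assert (E : curv g * metric (curv g) (cross x v) (cross x v)
     = polar (curv g) x x * polar (curv g) v v - polar (curv g) x v ^ 2)
    by vec_ring.
  rewrite H1, Hv, (polar_tangent g x v Hx Hv) in E.
  destruct g; unfold curv in *; try lra.
  destruct x as [[x1 x2] x3], v as [[v1 v2] v3].
  unfold Sigma, polar in *; simpl in *. subst x3.
  replace v3 with 0 by lra. vec_ring.
Qed.

Lemma metric_tangent_pos (g : geometry) (x v : vec) :
  Sigma g x -> polar (curv g) x v = 0 -> v <> zero ->
  0 < metric (curv g) v v.
Proof.
  intros Hx Hv Hn.
  destruct (Rlt_or_le 0 (metric (curv g) v v)) as [|H]; [assumption|].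
  exfalso; apply Hn. clear Hn.
  destruct x as [[x1 x2] x3], v as [[v1 v2] v3].
  assert (v1 = 0 /\ v2 = 0 /\ v3 = 0) as (-> & -> & ->); [|reflexivity].
  destruct g; unfold Sigma, polar, metric in *; simpl in *.
  - subst x3. assert (v3 = 0) by lra. assert (v1 = 0) by nra.
    assert (v2 = 0) by nra. auto.
  - assert (v1 = 0) by nra. assert (v2 = 0) by nra. assert (v3 = 0) by nra. auto.
  (* The hyperbolic form is indefinite. Tangency, x3 v3 = x1 v1 + x2 v2, eliminates v3 and turns
     x3^2 times the form into a sum of squares. *)
  - assert (E : x3 ^ 2 * (v1 * v1 + v2 * v2 + -1 * (v3 * v3))
      = v1 ^ 2 + v2 ^ 2 + (x1 * v2 - x2 * v1) ^ 2).
    { replace (x3 ^ 2 * (v1 * v1 + v2 * v2 + -1 * (v3 * v3)))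
        with (x3 ^ 2 * (v1 * v1 + v2 * v2) - (x3 * v3) ^ 2) by ring.
      replace (x3 * v3) with (x1 * v1 + x2 * v2) by lra.
      replace (x3 ^ 2) with (1 + x1 ^ 2 + x2 ^ 2) by lra. ring. }
    assert (H0 : 0 < x3 ^ 2) by nra.
    assert (S : v1 ^ 2 + v2 ^ 2 <= 0).
    { pose proof (pow2_ge_0 (x1 * v2 - x2 * v1)).
      pose proof (Rmult_le_compat_l (x3 ^ 2) _ _ (Rlt_le _ _ H0) H). lra. }
    assert (v1 = 0) by nra. assert (v2 = 0) by nra. subst v1 v2.
    assert (x3 * v3 = 0) by lra.
    assert (v3 = 0) by (destruct (Rmult_integral x3 v3); lra). auto.
Qed.

(** For x, v, w = c, c', c'' at one parameter and m a normal at another, this removes the derivative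
    of the speed and <c'', m> from the first variation; what remains is proportional to the
    determinant of c, c', c'', up to a curvature term. *)
Lemma polar_cross_frenet (e : R) (x v w m : vec) :
  metric e (cross x v) (cross x w) * polar e x (cross m (cross x v))
  - metric e (cross x v) (cross x v)
    * (polar e x x * dot w m - polar e x w * dot x m)
  + dot (cross x v) w * metric e (cross x v) m * polar e x x = 0.
Proof. vec_ring. Qed.

Lemma polar_cross_cross (e : R) (x y : vec) :
  polar e (cross x y) (cross x y) = metric e x x * metric e y y - metric e x y ^ 2.
Proof. vec_ring. Qed.

Lemma polar_cross_triple (e : R) (x v m : vec) :
  polar e x (cross m (cross x v)) = polar e x x * dot v m - polar e x v * dot x m.
Proof. vec_ring. Qed.

Lemma polar_norm_triple (e : R) (x v m : vec) :
  polar e (cross m (cross x v)) (cross m (cross x v))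
  = polar e x x * dot v m ^ 2 - 2 * polar e x v * dot x m * dot v m
    + polar e v v * dot x m ^ 2.
Proof. vec_ring. Qed.

(** The left side is (y × z) paired with (x × w) × (x × v), and the latter is a multiple of x. It is
    the numerator in the derivative of <y, n> / <z, n> when n = x × v has derivative x × w. *)
Lemma dot_cross_wronskian (x v w y z : vec) :
  dot y (cross x w) * dot z (cross x v) - dot y (cross x v) * dot z (cross x w)
  = - (dot (cross x v) w * dot x (cross y z)).
Proof. vec_ring. Qed.

(** * Lengths of geodesic segments *)

(** [atan], the identity or [atanh], for e = 1, 0, -1. *)
Definition arctan_curv (e r : R) : R := RInt (fun x => / (1 + e * x ^ 2)) 0 r.

Lemma one_plus_curv_pos (e r : R) : -1 <= e -> -1 < r < 1 -> 0 < 1 + e * r ^ 2.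
Proof. intros. nra. Qed.

Lemma arctan_curv_integrand_continuous (e r : R) :
  0 < 1 + e * r ^ 2 -> continuous (fun x => / (1 + e * x ^ 2)) r.
Proof.
  intros H. apply (ex_derive_continuous (fun x => / (1 + e * x ^ 2))).
  auto_derive. lra.
Qed.

Lemma is_derive_arctan_curv (e r : R) :
  -1 <= e -> -1 < r < 1 -> is_derive (arctan_curv e) r (/ (1 + e * r ^ 2)).
Proof.
  intros He Hr. unfold arctan_curv.
  apply (is_derive_RInt (fun x => / (1 + e * x ^ 2)) _ 0).
  - assert (Hd : 0 < Rmin (1 - r) (r + 1)) by (apply Rmin_pos; lra).
    exists (mkposreal _ Hd). intros y Hy.
    change (Rabs (y - r) < Rmin (1 - r) (r + 1)) in Hy.
    apply Rabs_def2 in Hy.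
    pose proof (Rmin_l (1 - r) (r + 1)). pose proof (Rmin_r (1 - r) (r + 1)).
    apply (RInt_correct (fun x => / (1 + e * x ^ 2))).
    apply (ex_RInt_continuous (fun x => / (1 + e * x ^ 2))).
    intros z Hz. apply arctan_curv_integrand_continuous, one_plus_curv_pos; [assumption|].
    revert Hz. unfold Rmin, Rmax. destruct Rle_dec; lra.
  - now apply arctan_curv_integrand_continuous, one_plus_curv_pos.
Qed.

Lemma arctan_curv_0 (e : R) : arctan_curv e 0 = 0.
Proof. unfold arctan_curv. rewrite RInt_point. reflexivity. Qed.

Lemma arctan_curv_opp (e r : R) : -1 <= e -> -1 < r < 1 ->
  arctan_curv e (- r) = - arctan_curv e r.
Proof.
  intros He Hr. unfold arctan_curv.
  assert (Hc : forall x, Rmin 0 r <= x <= Rmax 0 r -> 0 < 1 + e * x ^ 2).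
  { intros x Hx. apply one_plus_curv_pos; [assumption|].
    revert Hx. unfold Rmin, Rmax. destruct Rle_dec; lra. }
  change (- RInt (fun x => / (1 + e * x ^ 2)) 0 r)
    with (opp (RInt (fun x => / (1 + e * x ^ 2)) 0 r)).
  rewrite <- (RInt_opp (V := R_CompleteNormedModule) (fun x => / (1 + e * x ^ 2))).
  - rewrite <- Ropp_0 at 1.
    rewrite <- (RInt_comp (V := R_CompleteNormedModule)
      (fun x => / (1 + e * x ^ 2)) Ropp (fun _ => -1)).
    + apply RInt_ext. intros x _. unfold scal, opp; simpl. unfold mult; simpl.
      replace (- x * (- x * 1)) with (x * (x * 1)) by ring. ring.
    + intros x Hx. apply arctan_curv_integrand_continuous.
      replace ((- x) ^ 2) with (x ^ 2) by ring. now apply Hc.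
    + intros x _. split; [auto_derive; trivial; ring | apply continuous_const].
  - apply (ex_RInt_continuous (fun x => / (1 + e * x ^ 2))).
    intros x Hx. now apply arctan_curv_integrand_continuous, Hc.
Qed.

(** On this range 1 + e x^2 is at least 3/4, so the integrand stays below 2; a crude linear bound is
    enough to make the string defect small. *)
Lemma arctan_curv_bounds (e r : R) : -1 <= e -> 0 <= r <= / 2 ->
  0 <= arctan_curv e r <= 2 * r.
Proof.
  intros He Hr.
  destruct (MVT_gen (arctan_curv e) 0 r (fun x => / (1 + e * x ^ 2))) as (x & Hx & E).
  - intros x. unfold Rmin, Rmax. destruct Rle_dec; intros ?;
      apply is_derive_arctan_curv; lra.
  - intros x. unfold Rmin, Rmax. intros Hx. apply continuity_pt_filterlim.
    apply (ex_derive_continuous (arctan_curv e)). eexists.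
    apply is_derive_arctan_curv; destruct Rle_dec; lra.
  - rewrite arctan_curv_0 in E. rewrite Rmin_left, Rmax_right in Hx by lra.
    assert (/ 2 <= 1 + e * x ^ 2) by nra.
    assert (0 < / (1 + e * x ^ 2) <= 2).
    { split; [apply Rinv_0_lt_compat; lra|].
      rewrite <- (Rinv_inv 2). apply Rinv_le_contravar; lra. }
    nra.
Qed.

(** Radial projection to the surface in all three geometries at once: for e = 0 the root is |x3|. *)
Definition normalize (e : R) (x : vec) : vec := scal (/ sqrt (polar e x x)) x.

Definition chord (x y : vec) (s : R) : vec := plus (scal (1 - s) x) (scal s y).

Lemma coord_segment (g : geometry) (x y : vec) (s : R) (i : nat) :
  Sigma g x -> Sigma g y ->
  coord (segment g x y s) i = coord (normalize (curv g) (chord x y s)) i.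
Proof.
  intros Hx Hy. unfold segment, normalize. fold (chord x y s).
  destruct g.
  - replace (polar (curv Euclidean) (chord x y s) (chord x y s)) with 1.
    + rewrite sqrt_1, Rinv_1. destruct i as [|[|i]]; unfold chord; vec_ring.
    + destruct x as [[x1 x2] x3], y as [[y1 y2] y3]. unfold Sigma in *.
      simpl in Hx, Hy. subst. unfold chord. vec_ring.
  - rewrite form_Q. replace (metric _ _ _) with
      (polar (curv Spherical) (chord x y s) (chord x y s)) by vec_ring. reflexivity.
  - rewrite form_Q. replace (- metric _ _ _) with
      (polar (curv Hyperbolic) (chord x y s) (chord x y s)) by vec_ring. reflexivity.
Qed.

Lemma polar_chord (e : R) (x y : vec) (s : R) :
  polar e x x = 1 -> polar e y y = 1 ->
  polar e (chord x y s) (chord x y s) = (1 - s) ^ 2 + 2 * s * (1 - s) * polar e x y + s ^ 2.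
Proof.
  intros Hx Hy.
  replace (polar e (chord x y s) (chord x y s)) with
    ((1 - s) ^ 2 * polar e x x + 2 * s * (1 - s) * polar e x y + s ^ 2 * polar e y y)
    by (unfold chord; vec_ring).
  rewrite Hx, Hy. ring.
Qed.

Lemma coord_scal (a : R) (x : vec) (i : nat) : coord (scal a x) i = a * coord x i.
Proof. destruct i as [|[|i]]; reflexivity. Qed.

Lemma coord_plus (x y : vec) (i : nat) : coord (plus x y) i = coord x i + coord y i.
Proof. destruct i as [|[|i]]; reflexivity. Qed.

Lemma coord_minus (x y : vec) (i : nat) : coord (minus x y) i = coord x i - coord y i.
Proof. destruct i as [|[|i]]; reflexivity. Qed.

Lemma is_derive_div_sqrt (f q : R -> R) (s df dq : R) :
  is_derive f s df -> is_derive q s dq -> 0 < q s ->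
  is_derive (fun s => / sqrt (q s) * f s) s
    ((df * q s - f s * (dq / 2)) / (q s * sqrt (q s))).
Proof.
  intros Hf Hq H.
  pose proof (sqrt_lt_R0 _ H). pose proof (sqrt_sqrt _ (Rlt_le _ _ H)) as E.
  auto_derive.
  - repeat split; [now exists dq | exact H | lra | now exists df].
  - replace (Derive _ s) with dq by (symmetry; exact (is_derive_unique _ _ _ Hq)).
    replace (Derive _ s) with df by (symmetry; exact (is_derive_unique _ _ _ Hf)).
    set (N := sqrt (q s)) in *. rewrite <- E. field. lra.
Qed.

Lemma is_derive_normalize_chord (e : R) (x y : vec) (s : R) (i : nat) :
  let v := chord x y s in let w := minus y x in
  0 < polar e v v ->
  is_derive (fun s => coord (normalize e (chord x y s)) i) s
    ((coord w i * polar e v v - coord v i * polar e v w)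
      / (polar e v v * sqrt (polar e v v))).
Proof.
  intros v w H.
  apply (is_derive_ext (fun s => / sqrt (polar e (chord x y s) (chord x y s))
    * coord (chord x y s) i)).
  { intros t. symmetry. apply coord_scal. }
  replace (polar e v w) with (2 * polar e v w / 2) by field.
  apply (is_derive_div_sqrt (fun s => coord (chord x y s) i)
    (fun s => polar e (chord x y s) (chord x y s))); [| |exact H].
  - apply (is_derive_ext (fun s => (1 - s) * coord x i + s * coord y i)).
    + intros t. unfold chord. now rewrite coord_plus, !coord_scal.
    + unfold w. rewrite coord_minus. auto_derive; [trivial|ring].
  - apply (is_derive_ext (fun s => (1 - s) ^ 2 * polar e x x
      + 2 * s * (1 - s) * polar e x y + s ^ 2 * polar e y y)).
    + intros t. unfold chord. vec_ring.
    + auto_derive; [trivial|]. unfold w, v, chord. vec_ring.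
Qed.

(** Up to a positive factor, z is the derivative of the radial projection when v moves in the
    direction w. Its length involves w only through v × w, which by [cross_chord] is the same at all
    points of a chord. *)
Lemma metric_projection (g : geometry) (v w : vec) :
  let e := curv g in let z := minus (scal (polar e v v) w) (scal (polar e v w) v) in
  metric e z z = polar e v v * metric e (cross v w) (cross v w).
Proof. destruct g; vec_ring. Qed.

(** By [metric_projection] this is the squared length of the component of y tangent to the surface
    at x. *)
Lemma metric_cross_nonneg (g : geometry) (x y : vec) :
  Sigma g x -> 0 <= metric (curv g) (cross x y) (cross x y).
Proof.
  intros Hx. pose proof (Sigma_polar g x Hx) as Px.
  pose proof (metric_projection g x y) as E. cbv zeta in E.
  rewrite Px, Rmult_1_l in E. rewrite <- E. clear E.
  set (z := minus _ _).
  assert (Hz : polar (curv g) x z = 0).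
  { replace (polar (curv g) x z) with
      (polar (curv g) x y * (1 - polar (curv g) x x)) by (unfold z; vec_ring).
    rewrite Px. ring. }
  destruct (Req_dec (metric (curv g) z z) 0) as [->|Hn]; [lra|].
  apply Rlt_le, (metric_tangent_pos g x); [assumption..|].
  intros H0. apply Hn. rewrite H0. vec_ring.
Qed.

Lemma cross_chord (x y : vec) (s : R) : cross (chord x y s) (minus y x) = cross x y.
Proof. unfold chord. vec_eq. Qed.

Lemma velocity_unique (c : R -> vec) (s : R) (v : vec) :
  (forall i, is_derive (fun s => coord (c s) i) s (coord v i)) -> velocity c s = v.
Proof.
  intros H. apply vec_ext. intros [|[|i]].
  - exact (is_derive_unique _ _ _ (H 0%nat)).
  - exact (is_derive_unique _ _ _ (H 1%nat)).
  - exact (is_derive_unique _ _ _ (H 2%nat)).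
Qed.

Lemma speed_segment (g : geometry) (x y : vec) (s : R) :
  Sigma g x -> Sigma g y ->
  let e := curv g in let v := chord x y s in
  0 < polar e v v ->
  sqrt (form (Q g) (velocity (segment g x y) s) (velocity (segment g x y) s))
  = sqrt (metric e (cross x y) (cross x y)) / polar e v v.
Proof.
  intros Hx Hy e v H. set (w := minus y x).
  set (z := minus (scal (polar e v v) w) (scal (polar e v w) v)).
  set (k := / (polar e v v * sqrt (polar e v v))).
  assert (E : velocity (segment g x y) s = scal k z).
  { apply velocity_unique. intros i.
    apply (is_derive_ext (fun s => coord (normalize e (chord x y s)) i)).
    - intros t. symmetry. now apply coord_segment.
    - replace (coord (scal k z) i) with
        ((coord w i * polar e v v - coord v i * polar e v w)
          / (polar e v v * sqrt (polar e v v))).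
      + now apply is_derive_normalize_chord.
      + subst z k. clearbody w v. destruct i as [|[|i]]; simpl;
          unfold plus, scal, opp, mult; simpl; unfold plus, scal, opp, mult; simpl;
          unfold Rdiv; ring. }
  rewrite E, form_Q. fold e.
  pose proof (sqrt_lt_R0 _ H) as HN.
  pose proof (sqrt_sqrt _ (Rlt_le _ _ H)) as HN2.
  replace (metric e (scal k z) (scal k z)) with
    (metric e (cross x y) (cross x y) / polar e v v ^ 2).
  - rewrite sqrt_div_alt by (apply pow_lt; exact H).
    rewrite sqrt_pow2 by lra. reflexivity.
  - replace (metric e (scal k z) (scal k z)) with (k ^ 2 * metric e z z) by vec_ring.
    assert (Hz : metric e z z = polar e v v * metric e (cross x y) (cross x y)).
    { rewrite <- (cross_chord x y s). apply (metric_projection g). }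
    rewrite Hz. unfold k.
    set (N := sqrt (polar e v v)) in *. rewrite <- HN2. field. lra.
Qed.

(** [polar e x y] is the cosine of the distance and the square root of G its sine, in the sense of
    curvature e; [HG] is the Pythagorean relation between them. *)
Lemma segment_length_eq (g : geometry) (x y : vec) :
  Sigma g x -> Sigma g y ->
  let e := curv g in
  0 < polar e x y ->
  segment_length g x y
  = arctan_curv e (sqrt (metric e (cross x y) (cross x y)) / polar e x y).
Proof.
  intros Hx Hy e Hk.
  pose proof (Sigma_polar g x Hx) as Px. pose proof (Sigma_polar g y Hy) as Py.
  fold e in Px, Py.
  set (G := metric e (cross x y) (cross x y)).
  assert (HG : polar e x y ^ 2 + e * G = 1).
  { replace (e * G) with (polar e x x * polar e y y - polar e x y ^ 2)
      by (unfold G; vec_ring). rewrite Px, Py. ring. }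
  set (k := polar e x y) in *.
  assert (HG0 : 0 <= G).
  { now apply metric_cross_nonneg. }
  unfold segment_length, curve_length.
  assert (Hd : forall s, 0 <= s <= 1 -> 0 < 1 - s + s * k) by (intros; nra).
  assert (Hv : forall s, 0 <= s <= 1 -> 0 < polar e (chord x y s) (chord x y s)).
  { intros s Hs. rewrite polar_chord by assumption. fold k.
    pose proof (Rmult_le_pos (2 * s * (1 - s)) k). nra. }
  (* The tangent of the distance from x to the point at s. In this variable the speed is r' / (1 + e
     r^2), so the length becomes [arctan_curv] by substitution. *)
  set (r := fun s => s * sqrt G / (1 - s + s * k)).
  assert (Hr : forall s, 0 <= s <= 1 -> 1 + e * r s ^ 2
    = ((1 - s) ^ 2 + 2 * s * (1 - s) * k + s ^ 2) / (1 - s + s * k) ^ 2).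
  { intros s Hs. specialize (Hd s Hs). unfold r.
    replace ((s * sqrt G / (1 - s + s * k)) ^ 2)
      with (s ^ 2 * (sqrt G * sqrt G) / (1 - s + s * k) ^ 2) by (field; lra).
    rewrite sqrt_sqrt by exact HG0.
    replace (e * (s ^ 2 * G / (1 - s + s * k) ^ 2))
      with (s ^ 2 * (e * G) / (1 - s + s * k) ^ 2) by (field; lra).
    replace (e * G) with (1 - k ^ 2) by lra. field. lra. }
  replace (sqrt G / k) with (r 1) by (unfold r; field; lra).
  unfold arctan_curv. replace 0 with (r 0) at 2 by (unfold r, Rdiv; ring).
  rewrite <- (RInt_comp (V := R_CompleteNormedModule) (fun x => / (1 + e * x ^ 2)) r
    (fun s => sqrt G / (1 - s + s * k) ^ 2)).
  - apply RInt_ext. intros s Hs. rewrite Rmin_left, Rmax_right in Hs by lra.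
    rewrite speed_segment; [|assumption..|apply Hv; lra].
    fold e. fold G.
    change (sqrt G / polar e (chord x y s) (chord x y s)
      = sqrt G / (1 - s + s * k) ^ 2 * / (1 + e * r s ^ 2)).
    rewrite (polar_chord e x y) by assumption. fold k.
    pose proof (Hd s ltac:(lra)) as Hds. pose proof (Hr s ltac:(lra)) as Hrs.
    assert (Hvs : 0 < (1 - s) ^ 2 + 2 * s * (1 - s) * k + s ^ 2).
    { unfold k. rewrite <- polar_chord by assumption. apply Hv; lra. }
    rewrite Hrs. field. lra.
  - intros s Hs. rewrite Rmin_left, Rmax_right in Hs by lra.
    apply arctan_curv_integrand_continuous. rewrite Hr by assumption.
    apply Rdiv_lt_0_compat; [|apply pow_lt, Hd, Hs].
    unfold k. rewrite <- polar_chord by assumption. now apply Hv.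
  - intros s Hs. rewrite Rmin_left, Rmax_right in Hs by lra.
    specialize (Hd s Hs). split.
    + unfold r. auto_derive; [lra|]. field. lra.
    + apply (ex_derive_continuous (fun s => sqrt G / (1 - s + s * k) ^ 2)).
      auto_derive. assert (0 < (1 - s + s * k) ^ 2) by (apply pow_lt; lra).
      simpl in *; lra.
Qed.

(** * Two facts from one-variable calculus *)

Lemma is_derive_approx (f : R -> R) (a l eps : R) :
  is_derive f a l -> 0 < eps ->
  exists r, 0 < r /\ forall x, Rabs (x - a) < r ->
    Rabs (f x - f a - l * (x - a)) <= eps * Rabs (x - a).
Proof.
  intros [_ H] He.
  destruct (H a (fun P HP => HP) (mkposreal eps He)) as [r Hr].
  exists r. split; [apply cond_pos|]. intros x Hx. specialize (Hr x Hx).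
  change (Rabs (f x - f a - (x - a) * l) <= eps * Rabs (x - a)) in Hr.
  now rewrite (Rmult_comm l).
Qed.

(** If [t x + t y] is constant along the curve [f x = h y], the gradients of
    [t x + t y] and [f x - h y] are parallel. *)
Lemma level_set_slopes (f h t : R -> R) (a b l1 l2 ta tb r : R) :
  0 < l1 -> is_derive f a l1 -> is_derive h b l2 ->
  is_derive t a ta -> is_derive t b tb -> f a = h b -> 0 < r ->
  (forall x, Rabs (x - a) < r -> continuity_pt f x) ->
  (forall x y, Rabs (x - a) < r -> Rabs (y - b) < r -> f x = h y ->
    t x - t b = t a - t y) ->
  ta * l2 + tb * l1 = 0.
Proof.
  intros Hl1 Hf Hh Ha Hb E Hr Hc Ht.
  (* Replacing the four functions by their linear parts costs eps times the displacements. If y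
     moves by Y, then x moves by at most 2 (|l2| + 1) / l1 times Y, which explains the second
     factor; the first collects the weights of the errors. *)
  set (M := (Rabs ta + l1) * (1 + 2 * (Rabs l2 + 1) / l1)).
  assert (HM : 0 < M).
  { pose proof (Rabs_pos ta). pose proof (Rabs_pos l2).
    apply Rmult_lt_0_compat; [lra|].
    assert (0 < 2 * (Rabs l2 + 1) / l1) by (apply Rdiv_lt_0_compat; lra). lra. }
  enough (HK : forall eps, 0 < eps -> eps <= l1 / 2 -> eps <= 1 ->
    Rabs (ta * l2 + tb * l1) <= eps * M).
  { destruct (Req_dec (ta * l2 + tb * l1) 0) as [|Hn]; [assumption|exfalso].
    apply Rabs_pos_lt in Hn. set (K := Rabs (ta * l2 + tb * l1)) in *.
    set (eps := Rmin (Rmin (l1 / 2) 1) (K / (2 * M))).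
    assert (0 < K / (2 * M)) by (apply Rdiv_lt_0_compat; lra).
    assert (0 < eps) by (repeat apply Rmin_pos; lra).
    assert (eps <= l1 / 2 /\ eps <= 1) as [H1 H2].
    { split; (eapply Rle_trans; [apply Rmin_l|]); [apply Rmin_l|apply Rmin_r]. }
    assert (H3 : eps <= K / (2 * M)) by apply Rmin_r.
    specialize (HK eps ltac:(assumption) H1 H2).
    apply Rmult_le_compat_r with (r := M) in H3; [|lra].
    replace (K / (2 * M) * M) with (K / 2) in H3 by (field; lra). lra. }
  intros eps He He1 He2.
  destruct (is_derive_approx f a l1 eps Hf He) as (rf & Hrf & Af).
  destruct (is_derive_approx h b l2 eps Hh He) as (rh & Hrh & Ah).
  destruct (is_derive_approx t a ta eps Ha He) as (ra & Hra & Aa).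
  destruct (is_derive_approx t b tb eps Hb He) as (rb & Hrb & Ab).
  (* Since eps <= l1 / 2, the values of f at a - xi and a + xi differ from f a by at least l1 xi /
     2, on opposite sides. *)
  set (xi := Rmin (Rmin rf ra) r / 2).
  assert (0 < xi /\ xi < rf /\ xi < ra /\ xi < r) as (Hxi & Hxf & Hxa & Hxr).
  { assert (0 < Rmin (Rmin rf ra) r) by (repeat apply Rmin_pos; lra).
    pose proof (Rmin_l (Rmin rf ra) r). pose proof (Rmin_r (Rmin rf ra) r).
    pose proof (Rmin_l rf ra). pose proof (Rmin_r rf ra). unfold xi. lra. }
  (* The last bound keeps |h y - h b| below l1 xi / 2, so that h y is a value of f between a - xi
     and a + xi. *)
  set (w := Rmin (Rmin (Rmin rh rb) r) (l1 * xi / (2 * (Rabs l2 + 1)))).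
  pose proof (Rabs_pos l2) as Hl2.
  assert (0 < l1 * xi / (2 * (Rabs l2 + 1))) as Hq.
  { apply Rdiv_lt_0_compat; [apply Rmult_lt_0_compat|]; lra. }
  set (Y := w / 2).
  assert (0 < Y /\ Y < rh /\ Y < rb /\ Y < r /\ Y < l1 * xi / (2 * (Rabs l2 + 1)))
    as (HY & HYh & HYb & HYr & HYq).
  { assert (0 < w) by (unfold w; repeat apply Rmin_pos; lra).
    unfold Y.
    pose proof (Rmin_l (Rmin (Rmin rh rb) r) (l1 * xi / (2 * (Rabs l2 + 1)))).
    pose proof (Rmin_r (Rmin (Rmin rh rb) r) (l1 * xi / (2 * (Rabs l2 + 1)))).
    fold w in H0, H1.
    pose proof (Rmin_l (Rmin rh rb) r). pose proof (Rmin_r (Rmin rh rb) r).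
    pose proof (Rmin_l rh rb). pose proof (Rmin_r rh rb). lra. }
  set (y := b + Y).
  assert (EY : y - b = Y) by (unfold y; ring).
  assert (AY : Rabs (y - b) = Y) by (rewrite EY; apply Rabs_pos_eq; lra).
  specialize (Ah y). specialize (Ab y). rewrite AY in Ah, Ab. rewrite EY in Ah, Ab.
  specialize (Ah HYh). specialize (Ab HYb).
  assert (Hhy : Rabs (h y - h b) <= (Rabs l2 + 1) * Y).
  { replace (h y - h b) with ((h y - h b - l2 * Y) + l2 * Y) by ring.
    eapply Rle_trans; [apply Rabs_triang|].
    rewrite Rabs_mult, (Rabs_pos_eq Y) by lra. nra. }
  assert (Hhx : Rabs (h y - h b) < l1 / 2 * xi).
  { eapply Rle_lt_trans; [exact Hhy|].
    apply Rmult_lt_compat_l with (r := Rabs l2 + 1) in HYq; [|lra].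
    replace ((Rabs l2 + 1) * (l1 * xi / (2 * (Rabs l2 + 1))))
      with (l1 / 2 * xi) in HYq by (field; lra). exact HYq. }
  apply Rabs_def2 in Hhx.
  assert (Hup : l1 / 2 * xi <= f (a + xi) - f a).
  { specialize (Af (a + xi)). replace (a + xi - a) with xi in Af by ring.
    rewrite Rabs_pos_eq in Af by lra. specialize (Af Hxf).
    apply Rabs_le_between in Af. nra. }
  assert (Hdn : f (a - xi) - f a <= - (l1 / 2 * xi)).
  { specialize (Af (a - xi)). replace (a - xi - a) with (- xi) in Af by ring.
    rewrite Rabs_Ropp, Rabs_pos_eq in Af by lra. specialize (Af Hxf).
    apply Rabs_le_between in Af. nra. }
  destruct (IVT_interv (fun x => f x - h y) (a - xi) (a + xi)) as (x & Hx & Ex).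
  { intros x Hx. apply continuity_pt_minus; [|apply continuity_pt_const; congruence].
    apply Hc. apply Rabs_def1; lra. }
  all: try lra.
  assert (Hax : Rabs (x - a) <= xi) by (apply Rabs_le; lra).
  specialize (Af x ltac:(lra)). specialize (Aa x ltac:(lra)).
  specialize (Ht x y ltac:(lra) ltac:(lra) ltac:(lra)).
  set (X := x - a) in *.
  (* The intermediate value theorem only gives |X| <= xi. A bound linear in Y follows from l1 |X| <=
     |f x - f a| + eps |X| after absorbing the last term. *)
  assert (HX : Rabs X <= 2 * (Rabs l2 + 1) / l1 * Y).
  { assert (HX1 : l1 * Rabs X <= Rabs (f x - f a) + eps * Rabs X).
    { rewrite <- (Rabs_pos_eq l1) at 1 by lra. rewrite <- Rabs_mult.
      replace (l1 * X) with ((f x - f a) - (f x - f a - l1 * X)) by ring.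
      unfold Rminus at 1. eapply Rle_trans; [apply Rabs_triang|].
      rewrite Rabs_Ropp. lra. }
    replace (f x - f a) with (h y - h b) in HX1 by lra.
    pose proof (Rabs_pos X).
    assert (l1 / 2 * Rabs X <= (Rabs l2 + 1) * Y) by nra.
    apply Rmult_le_reg_l with (l1 / 2); [lra|].
    replace (l1 / 2 * (2 * (Rabs l2 + 1) / l1 * Y)) with ((Rabs l2 + 1) * Y)
      by (field; lra). lra. }
  apply Rmult_le_reg_r with Y; [lra|].
  rewrite <- (Rabs_pos_eq Y) at 1 by lra. rewrite <- Rabs_mult.
  (* The linear parts cancel through f x = h y and t x - t b = t a - t y, which leaves a combination
     of the four remainders. *)
  replace ((ta * l2 + tb * l1) * Y) with
    (ta * ((f x - f a - l1 * X) - (h y - h b - l2 * Y))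
     - l1 * ((t x - t a - ta * X) + (t y - t b - tb * Y))).
  2:{ replace (f x) with (h y) by lra. rewrite E.
      replace (t x) with (t a - t y + t b) by lra. ring. }
  unfold Rminus at 1. eapply Rle_trans; [apply Rabs_triang|].
  rewrite Rabs_Ropp, !Rabs_mult, (Rabs_pos_eq l1) by lra.
  set (B := 2 * (Rabs l2 + 1) / l1 * Y) in *.
  assert (H1 : Rabs ((f x - f a - l1 * X) - (h y - h b - l2 * Y)) <= eps * (Y + B)).
  { unfold Rminus at 1. eapply Rle_trans; [apply Rabs_triang|].
    rewrite Rabs_Ropp. nra. }
  assert (H2 : Rabs ((t x - t a - ta * X) + (t y - t b - tb * Y)) <= eps * (Y + B)).
  { eapply Rle_trans; [apply Rabs_triang|]. nra. }
  replace (eps * M * Y) with (Rabs ta * (eps * (Y + B)) + l1 * (eps * (Y + B)))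
    by (unfold M, B; field; lra).
  pose proof (Rabs_pos ta).
  apply Rplus_le_compat; apply Rmult_le_compat_l; lra.
Qed.

(** By the mean value theorem f x = f1 xi (x - y). Since f1 vanishes at y and is strictly monotone,
    q = f1 xi / f1 x lies in (0, 1]. The factor d carries the sign of the second derivative. *)
Lemma convex_quotient (f f1 f2 : R -> R) (x y d : R) :
  x <> y ->
  (forall z, Rmin y x <= z <= Rmax y x ->
    is_derive f z (f1 z) /\ is_derive f1 z (f2 z) /\ 0 < d * f2 z) ->
  f y = 0 -> f1 y = 0 ->
  0 < d * f x /\ 0 < d * ((x - y) * f1 x) /\
  exists q, 0 < q <= 1 /\ f x / f1 x = q * (x - y).
Proof.
  intros Hxy H Hf Hf1.
  assert (MV : forall u v, Rmin y x <= u <= Rmax y x -> Rmin y x <= v <= Rmax y x ->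
    exists z, Rmin u v <= z <= Rmax u v /\ f1 v - f1 u = f2 z * (v - u)
      /\ 0 < d * f2 z).
  { intros u v Hu Hv.
    assert (Hs : forall z, Rmin u v <= z <= Rmax u v -> Rmin y x <= z <= Rmax y x).
    { intros z. pose proof (Rmin_Rgt_l u v). unfold Rmin at 1, Rmax at 1.
      destruct Rle_dec; lra. }
    destruct (MVT_gen f1 u v f2) as (z & Hz & E).
    - intros z Hz. apply H, Hs. lra.
    - intros z Hz. apply continuity_pt_filterlim, (ex_derive_continuous f1).
      exists (f2 z). apply H, Hs, Hz.
    - exists z. split; [assumption|]. split; [assumption|]. apply H, Hs, Hz. }
  (* The form of the mean value theorem with a strictly interior point is needed here: xi <> y makes
     q positive. *)
  assert (exists xi, 0 < (x - y) * (xi - y) /\ 0 <= (x - y) * (x - xi)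
    /\ f x - f y = f1 xi * (x - y)) as (xi & A1 & A2 & E).
  { assert (Hd : forall z, Rmin y x <= z <= Rmax y x -> derivable_pt_lim f z (f1 z)).
    { intros z Hz. apply is_derive_Reals. now apply H. }
    unfold Rmin, Rmax in Hd.
    destruct (Rtotal_order y x) as [Hlt|[->|Hgt]]; [|congruence|].
    - destruct (MVT_cor2 f f1 y x Hlt) as (xi & E & Hxi).
      + intros z Hz. apply Hd. destruct Rle_dec; lra.
      + exists xi. split; [nra|]. split; [nra|assumption].
    - destruct (MVT_cor2 f f1 x y Hgt) as (xi & E & Hxi).
      + intros z Hz. apply Hd. destruct Rle_dec; lra.
      + exists xi. split; [nra|]. split; [nra|lra]. }
  assert (Hxi : Rmin y x <= xi <= Rmax y x).
  { unfold Rmin, Rmax. destruct Rle_dec; nra. }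
  assert (Hy : Rmin y x <= y <= Rmax y x) by (split; [apply Rmin_l|apply Rmax_l]).
  assert (Hx : Rmin y x <= x <= Rmax y x) by (split; [apply Rmin_r|apply Rmax_r]).
  destruct (MV y x Hy Hx) as (z1 & _ & E1 & P1).
  destruct (MV y xi Hy Hxi) as (z2 & _ & E2 & P2).
  destruct (MV xi x Hxi Hx) as (z3 & _ & E3 & P3).
  rewrite Hf1, Rminus_0_r in E1, E2. rewrite Hf, Rminus_0_r in E.
  assert (HD : 0 < d * ((x - y) * f1 x)).
  { rewrite E1. replace (d * ((x - y) * (f2 z1 * (x - y))))
      with ((d * f2 z1) * (x - y) ^ 2) by ring.
    apply Rmult_lt_0_compat; [assumption|]. nra. }
  assert (Hn : f1 x <> 0) by (intros H0; rewrite H0 in HD; lra).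
  assert (Hq : 0 < d * ((x - y) * f1 xi) <= d * ((x - y) * f1 x)).
  { replace (f1 x) with (f1 xi + f2 z3 * (x - xi)) by lra. rewrite E2.
    pose proof (Rmult_lt_0_compat _ _ P2 A1).
    pose proof (Rmult_le_pos _ _ (Rlt_le _ _ P3) A2). lra. }
  split; [|split; [assumption|]].
  - rewrite E. lra.
  - exists (d * ((x - y) * f1 xi) / (d * ((x - y) * f1 x))). repeat split.
    + now apply Rdiv_lt_0_compat.
    + apply Rle_div_l; lra.
    + rewrite E. field. repeat split; try lra. intros H0. rewrite H0 in HD. lra.
Qed.

(** * Arcs lying on one side of their tangents *)

Definition is_vderive (f : R -> vec) (s : R) (v : vec) : Prop :=
  forall i, is_derive (fun x => coord (f x) i) s (coord v i).

Lemma is_vderive_const (v : vec) (s : R) : is_vderive (fun _ => v) s zero.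
Proof.
  intros i. replace (coord zero i) with 0 by (destruct i as [|[|i]]; reflexivity).
  apply (is_derive_const (coord v i)).
Qed.

Lemma is_derive_Rmult (f h : R -> R) (s df dh : R) :
  is_derive f s df -> is_derive h s dh ->
  is_derive (fun x => f x * h x) s (df * h s + f s * dh).
Proof. intros Hf Hh. apply (is_derive_mult f h s df dh Hf Hh), Rmult_comm. Qed.

Lemma is_derive_Rplus (f h : R -> R) (s df dh : R) :
  is_derive f s df -> is_derive h s dh ->
  is_derive (fun x => f x + h x) s (df + dh).
Proof. apply (is_derive_plus f h s df dh). Qed.

Lemma is_derive_Rminus (f h : R -> R) (s df dh : R) :
  is_derive f s df -> is_derive h s dh ->
  is_derive (fun x => f x - h x) s (df - dh).
Proof. apply (is_derive_minus f h s df dh). Qed.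

Lemma is_derive_Rscal (f : R -> R) (s k df : R) :
  is_derive f s df -> is_derive (fun x => k * f x) s (k * df).
Proof. apply (is_derive_scal f s k df). Qed.

Lemma is_derive_value (f : R -> R) (s l l' : R) :
  is_derive f s l -> l = l' -> is_derive f s l'.
Proof. now intros H <-. Qed.

Ltac vec_derive Hf Hh :=
  pose proof (Hf 0%nat); pose proof (Hf 1%nat); pose proof (Hf 2%nat);
  pose proof (Hh 0%nat); pose proof (Hh 1%nat); pose proof (Hh 2%nat);
  unfold metric, polar, dot, cross; simpl in *;
  eapply is_derive_value;
  [ repeat match goal with
    | |- is_derive (fun _ => _ - _) _ _ => apply is_derive_Rminus
    | |- is_derive (fun _ => _ + _) _ _ => apply is_derive_Rplus
    | |- is_derive (fun _ => ?k * _) _ _ => apply is_derive_Rscal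
    | |- is_derive (fun _ => _ * _) _ _ => apply is_derive_Rmult
    | |- _ => eassumption
    end
  | vec_ring ].

Lemma is_vderive_cross (f h : R -> vec) (s : R) (df dh : vec) :
  is_vderive f s df -> is_vderive h s dh ->
  is_vderive (fun x => cross (f x) (h x)) s (plus (cross df (h s)) (cross (f s) dh)).
Proof. intros Hf Hh [|[|i]]; vec_derive Hf Hh. Qed.

Lemma is_derive_dot (f h : R -> vec) (s : R) (df dh : vec) :
  is_vderive f s df -> is_vderive h s dh ->
  is_derive (fun x => dot (f x) (h x)) s (dot df (h s) + dot (f s) dh).
Proof. intros Hf Hh. vec_derive Hf Hh. Qed.

Lemma is_derive_metric (e : R) (f h : R -> vec) (s : R) (df dh : vec) :
  is_vderive f s df -> is_vderive h s dh ->
  is_derive (fun x => metric e (f x) (h x)) s (metric e df (h s) + metric e (f s) dh).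
Proof. intros Hf Hh. vec_derive Hf Hh. Qed.

Lemma is_derive_polar (e : R) (f h : R -> vec) (s : R) (df dh : vec) :
  is_vderive f s df -> is_vderive h s dh ->
  is_derive (fun x => polar e (f x) (h x)) s (polar e df (h s) + polar e (f s) dh).
Proof. intros Hf Hh. vec_derive Hf Hh. Qed.

Definition accel (c : R -> vec) (s : R) : vec := velocity (velocity c) s.

Definition normal (c : R -> vec) (s : R) : vec := cross (c s) (velocity c s).

Definition speed (g : geometry) (c : R -> vec) (s : R) : R :=
  sqrt (metric (curv g) (velocity c s) (velocity c s)).

(** The point [c x - tangent_ratio c x y * velocity c x] spans the intersection
    of the planes of the geodesics tangent at [x] and at [y]. *)
Definition tangent_ratio (c : R -> vec) (x y : R) : R :=
  dot (c x) (normal c y) / dot (velocity c x) (normal c y).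

(** The two tangent ratios have opposite signs, so for y < x the subtraction adds the lengths.
    Without absolute values the expression is smooth off the diagonal and antisymmetric, and its
    derivative in y follows from the one in x. *)
Definition defect (g : geometry) (c : R -> vec) (x y : R) : R :=
  arctan_curv (curv g) (tangent_ratio c x y * speed g c x)
  - arctan_curv (curv g) (tangent_ratio c y x * speed g c y)
  - RInt (speed g c) y x.

Record C2_arc (g : geometry) (c : R -> vec) (s0 eta : R) : Prop := {
  C2_derive : forall s, Rabs (s - s0) < eta -> is_vderive c s (velocity c s);
  C2_derive2 : forall s, Rabs (s - s0) < eta -> is_vderive (velocity c) s (accel c s);
  C2_Sigma : forall s, Rabs (s - s0) < eta -> Sigma g (c s)
}.

(** On the interval of radius [eta] the curve stays on one side of its tangents
    ([d] records the side), and the tangent lengths are less than 1/2. *)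
Record regular_arc (g : geometry) (c : R -> vec) (s0 eta d : R) : Prop := {
  arc_C2 : C2_arc g c s0 eta;
  arc_convex : forall x y, Rabs (x - s0) < eta -> Rabs (y - s0) < eta ->
    0 < d * dot (accel c x) (normal c y);
  arc_short : forall s, Rabs (s - s0) < eta -> 4 * eta * speed g c s < 1
}.

Lemma locally_of_radius (s0 eta s : R) (P : R -> Prop) :
  Rabs (s - s0) < eta -> (forall x, Rabs (x - s0) < eta -> P x) -> locally s P.
Proof.
  intros Hs HP. assert (H : 0 < eta - Rabs (s - s0)) by lra.
  exists (mkposreal _ H). intros x Hx.
  change (Rabs (x - s) < eta - Rabs (s - s0)) in Hx. apply HP.
  replace (x - s0) with ((x - s) + (s - s0)) by ring.
  eapply Rle_lt_trans; [apply Rabs_triang|lra].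
Qed.

Lemma C2_tangent (g : geometry) (c : R -> vec) (s0 eta s : R) :
  C2_arc g c s0 eta -> Rabs (s - s0) < eta ->
  polar (curv g) (c s) (velocity c s) = 0.
Proof.
  intros A Hs. pose proof (C2_derive _ _ _ _ A s Hs) as D.
  pose proof (is_derive_unique _ _ _ (is_derive_polar (curv g) c c s _ _ D D)) as E.
  rewrite (Derive_ext_loc _ (fun _ => 1)), Derive_const in E.
  - replace (polar (curv g) (velocity c s) (c s)) with
      (polar (curv g) (c s) (velocity c s)) in E by vec_ring. lra.
  - apply (locally_of_radius s0 eta); [assumption|]. intros x Hx.
    apply Sigma_polar. now apply (C2_Sigma _ _ _ _ A).
Qed.

Lemma C2_accel (g : geometry) (c : R -> vec) (s0 eta s : R) :
  C2_arc g c s0 eta -> Rabs (s - s0) < eta ->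
  polar (curv g) (c s) (accel c s)
  = - (curv g * metric (curv g) (velocity c s) (velocity c s)).
Proof.
  intros A Hs. pose proof (C2_derive _ _ _ _ A s Hs) as D.
  pose proof (C2_derive2 _ _ _ _ A s Hs) as D2.
  pose proof (is_derive_unique _ _ _
    (is_derive_polar (curv g) c (velocity c) s _ _ D D2)) as E.
  rewrite (Derive_ext_loc _ (fun _ => 0)), Derive_const in E.
  - rewrite <- (polar_tangent g (c s)).
    + lra.
    + now apply (C2_Sigma _ _ _ _ A).
    + now apply (C2_tangent g c s0 eta).
  - apply (locally_of_radius s0 eta); [assumption|]. intros x Hx.
    now apply (C2_tangent g c s0 eta).
Qed.

Lemma arc_derive (g : geometry) (c : R -> vec) (s0 eta d s : R) :
  regular_arc g c s0 eta d -> Rabs (s - s0) < eta -> is_vderive c s (velocity c s).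
Proof. intros [A _ _]. apply A. Qed.

Lemma arc_derive2 (g : geometry) (c : R -> vec) (s0 eta d s : R) :
  regular_arc g c s0 eta d -> Rabs (s - s0) < eta ->
  is_vderive (velocity c) s (accel c s).
Proof. intros [A _ _]. apply A. Qed.

Lemma arc_Sigma (g : geometry) (c : R -> vec) (s0 eta d s : R) :
  regular_arc g c s0 eta d -> Rabs (s - s0) < eta -> Sigma g (c s).
Proof. intros [A _ _]. apply A. Qed.

Lemma arc_tangent (g : geometry) (c : R -> vec) (s0 eta d s : R) :
  regular_arc g c s0 eta d -> Rabs (s - s0) < eta ->
  polar (curv g) (c s) (velocity c s) = 0.
Proof. intros [A _ _]. now apply C2_tangent. Qed.

Lemma arc_accel (g : geometry) (c : R -> vec) (s0 eta d s : R) :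
  regular_arc g c s0 eta d -> Rabs (s - s0) < eta ->
  polar (curv g) (c s) (accel c s)
  = - (curv g * metric (curv g) (velocity c s) (velocity c s)).
Proof. intros [A _ _]. now apply (C2_accel g c s0 eta). Qed.

Lemma arc_metric_pos (g : geometry) (c : R -> vec) (s0 eta d s : R) :
  regular_arc g c s0 eta d -> Rabs (s - s0) < eta ->
  0 < metric (curv g) (velocity c s) (velocity c s).
Proof.
  intros A Hs. apply (metric_tangent_pos g (c s)).
  - now apply (arc_Sigma g c s0 eta d).
  - now apply (arc_tangent g c s0 eta d).
  - intros E. pose proof (arc_convex _ _ _ _ _ A s s Hs Hs) as H.
    unfold normal in H. rewrite E in H.
    replace (dot (accel c s) (cross (c s) zero)) with 0 in H by vec_ring. lra.
Qed.

Lemma speed_pos (g : geometry) (c : R -> vec) (s0 eta d s : R) :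
  regular_arc g c s0 eta d -> Rabs (s - s0) < eta -> 0 < speed g c s.
Proof. intros A Hs. apply sqrt_lt_R0. now apply (arc_metric_pos g c s0 eta d). Qed.

Lemma speed_sqr (g : geometry) (c : R -> vec) (s0 eta d s : R) :
  regular_arc g c s0 eta d -> Rabs (s - s0) < eta ->
  speed g c s ^ 2 = metric (curv g) (velocity c s) (velocity c s).
Proof.
  intros A Hs. apply pow2_sqrt, Rlt_le. now apply (arc_metric_pos g c s0 eta d).
Qed.

Lemma metric_normal (g : geometry) (c : R -> vec) (s0 eta d s : R) :
  regular_arc g c s0 eta d -> Rabs (s - s0) < eta ->
  metric (curv g) (normal c s) (normal c s)
  = metric (curv g) (velocity c s) (velocity c s).
Proof.
  intros A Hs. apply metric_cross_tangent.
  - now apply (arc_Sigma g c s0 eta d).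
  - now apply (arc_tangent g c s0 eta d).
Qed.

Lemma is_vderive_normal (g : geometry) (c : R -> vec) (s0 eta d s : R) :
  regular_arc g c s0 eta d -> Rabs (s - s0) < eta ->
  is_vderive (normal c) s (cross (c s) (accel c s)).
Proof.
  intros A Hs. pose proof (arc_derive _ _ _ _ _ s A Hs) as D.
  pose proof (arc_derive2 _ _ _ _ _ s A Hs) as D2.
  replace (cross (c s) (accel c s)) with
    (plus (cross (velocity c s) (velocity c s)) (cross (c s) (accel c s)))
    by vec_eq.
  now apply (is_vderive_cross c (velocity c)).
Qed.

(** The speed is differentiated as the length of the normal, whose derivative is c × c''; this is
    the form in which [polar_cross_frenet] can eliminate it. *)
Lemma is_derive_speed (g : geometry) (c : R -> vec) (s0 eta d s : R) :
  regular_arc g c s0 eta d -> Rabs (s - s0) < eta ->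
  is_derive (speed g c) s
    (metric (curv g) (normal c s) (cross (c s) (accel c s)) / speed g c s).
Proof.
  intros A Hs. pose proof (speed_pos g c s0 eta d s A Hs) as Hu.
  apply (is_derive_ext_loc (fun s => sqrt (metric (curv g) (normal c s) (normal c s)))).
  { apply (locally_of_radius s0 eta); [assumption|]. intros x Hx.
    unfold speed. now rewrite (metric_normal g c s0 eta d). }
  pose proof (is_vderive_normal g c s0 eta d s A Hs) as D.
  pose proof (is_derive_metric (curv g) _ _ s _ _ D D) as E.
  eapply is_derive_value.
  - apply (is_derive_comp sqrt (fun s => metric (curv g) (normal c s) (normal c s))).
    + apply is_derive_Reals, derivable_pt_lim_sqrt.
      rewrite (metric_normal g c s0 eta d) by assumption.
      now apply (arc_metric_pos g c s0 eta d).
    + exact E.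
  - rewrite (metric_normal g c s0 eta d) by assumption. fold (speed g c s).
    replace (metric (curv g) (cross (c s) (accel c s)) (normal c s)) with
      (metric (curv g) (normal c s) (cross (c s) (accel c s))) by vec_ring.
    unfold scal; simpl. unfold mult; simpl. field. lra.
Qed.

Lemma speed_continuous (g : geometry) (c : R -> vec) (s0 eta d s : R) :
  regular_arc g c s0 eta d -> Rabs (s - s0) < eta -> continuous (speed g c) s.
Proof.
  intros A Hs. apply (ex_derive_continuous (speed g c)). eexists.
  now apply (is_derive_speed g c s0 eta d).
Qed.

Lemma Rabs_between (s0 eta x y z : R) :
  Rabs (x - s0) < eta -> Rabs (y - s0) < eta -> Rmin y x <= z <= Rmax y x ->
  Rabs (z - s0) < eta.
Proof.
  intros Hx Hy. apply Rabs_def2 in Hx. apply Rabs_def2 in Hy.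
  unfold Rmin, Rmax. destruct Rle_dec; intros; apply Rabs_def1; lra.
Qed.

(** For fixed y, the function <c(x), n(y)> vanishes together with its derivative at x = y, and
    convexity gives its second derivative the sign of d. *)
Lemma tangent_ratio_bounds (g : geometry) (c : R -> vec) (s0 eta d x y : R) :
  regular_arc g c s0 eta d -> Rabs (x - s0) < eta -> Rabs (y - s0) < eta -> x <> y ->
  0 < d * dot (c x) (normal c y) /\
  0 < d * ((x - y) * dot (velocity c x) (normal c y)) /\
  exists q, 0 < q <= 1 /\ tangent_ratio c x y = q * (x - y).
Proof.
  intros A Hx Hy Hxy.
  apply (convex_quotient (fun x => dot (c x) (normal c y))
    (fun x => dot (velocity c x) (normal c y)) (fun x => dot (accel c x) (normal c y)));
    [assumption| |unfold normal; vec_ring..].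
  intros z Hz. pose proof (Rabs_between _ _ _ _ _ Hx Hy Hz) as Hzs.
  assert (Dot : forall f df, is_vderive f z df ->
    is_derive (fun x => dot (f x) (normal c y)) z (dot df (normal c y))).
  { intros f df D. eapply is_derive_value.
    - apply is_derive_dot; [exact D|apply is_vderive_const].
    - vec_ring. }
  split; [|split].
  - apply Dot. now apply (arc_derive g c s0 eta d).
  - apply Dot. now apply (arc_derive2 g c s0 eta d).
  - now apply (arc_convex _ _ _ _ _ A).
Qed.

Lemma tangent_length_bounds (g : geometry) (c : R -> vec) (s0 eta d x y : R) :
  regular_arc g c s0 eta d -> Rabs (x - s0) < eta -> Rabs (y - s0) < eta -> y < x ->
  0 < tangent_ratio c x y * speed g c x <= (x - y) * speed g c x /\
  0 < - tangent_ratio c y x * speed g c y <= (x - y) * speed g c y /\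
  (x - y) * speed g c x < / 2 /\ (x - y) * speed g c y < / 2.
Proof.
  intros A Hx Hy Hxy.
  destruct (tangent_ratio_bounds g c s0 eta d x y A Hx Hy) as (_ & _ & q & Hq & ->); [lra|].
  destruct (tangent_ratio_bounds g c s0 eta d y x A Hy Hx) as (_ & _ & r & Hr & ->); [lra|].
  pose proof (speed_pos g c s0 eta d x A Hx). pose proof (speed_pos g c s0 eta d y A Hy).
  pose proof (arc_short _ _ _ _ _ A x Hx). pose proof (arc_short _ _ _ _ _ A y Hy).
  apply Rabs_def2 in Hx. apply Rabs_def2 in Hy.
  assert (0 < (x - y) * speed g c x) by nra.
  assert (0 < (x - y) * speed g c y) by nra.
  repeat split; nra.
Qed.

(** * Intersection point of two tangent geodesics *)

Definition tangent_point (g : geometry) (c : R -> vec) (x y : R) : vec :=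
  normalize (curv g) (minus (c x) (scal (tangent_ratio c x y) (velocity c x))).

Lemma tangent_length_lt_1 (g : geometry) (c : R -> vec) (s0 eta d x y : R) :
  regular_arc g c s0 eta d -> Rabs (x - s0) < eta -> Rabs (y - s0) < eta -> x <> y ->
  -1 < tangent_ratio c x y * speed g c x < 1.
Proof.
  intros A Hx Hy Hxy. destruct (Rdichotomy _ _ Hxy) as [H|H].
  - pose proof (tangent_length_bounds g c s0 eta d y x A Hy Hx H). lra.
  - pose proof (tangent_length_bounds g c s0 eta d x y A Hx Hy H). lra.
Qed.

Lemma polar_tangent_vector (g : geometry) (c : R -> vec) (s0 eta d x k : R) :
  regular_arc g c s0 eta d -> Rabs (x - s0) < eta ->
  let v := minus (c x) (scal k (velocity c x)) in
  polar (curv g) v v = 1 + curv g * (k * speed g c x) ^ 2.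
Proof.
  intros A Hx v.
  replace (polar (curv g) v v) with (polar (curv g) (c x) (c x)
    - 2 * k * polar (curv g) (c x) (velocity c x)
    + k ^ 2 * polar (curv g) (velocity c x) (velocity c x)) by (unfold v; vec_ring).
  pose proof (arc_Sigma _ _ _ _ _ x A Hx) as S.
  pose proof (arc_tangent _ _ _ _ _ _ A Hx) as T.
  rewrite (Sigma_polar g _ S), (polar_tangent g (c x) _ S T), T,
    Rpow_mult_distr, (speed_sqr _ _ _ _ _ _ A Hx). ring.
Qed.

(** In the hyperbolic case the value is 1 - (k u)^2, with k the tangent ratio and u the speed: the
    tangent lines meet on the surface only because the arc is short. *)
Lemma polar_tangent_vector_pos (g : geometry) (c : R -> vec) (s0 eta d x y : R) :
  regular_arc g c s0 eta d -> Rabs (x - s0) < eta -> Rabs (y - s0) < eta -> x <> y ->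
  let v := minus (c x) (scal (tangent_ratio c x y) (velocity c x)) in
  0 < polar (curv g) v v.
Proof.
  intros A Hx Hy Hxy v. unfold v.
  rewrite (polar_tangent_vector g c s0 eta d) by assumption.
  apply one_plus_curv_pos; [apply curv_bounds|].
  now apply (tangent_length_lt_1 g c s0 eta d).
Qed.

Lemma normalize_scal (e k : R) (v : vec) : 0 < k -> normalize e (scal k v) = normalize e v.
Proof.
  intros Hk. unfold normalize.
  replace (polar e (scal k v) (scal k v)) with (k ^ 2 * polar e v v) by vec_ring.
  rewrite sqrt_mult_alt by (apply pow2_ge_0). rewrite sqrt_pow2 by lra.
  rewrite Rinv_mult. apply vec_ext. intros i. rewrite !coord_scal.
  set (r := / sqrt (polar e v v)). field. lra.
Qed.

(** Cleared of denominators, both vectors are n(x) × n(y) up to sign, hence proportional with factor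
    -q / p. Convexity makes this factor positive, so normalization does not produce antipodal
    points. *)
Lemma tangent_point_comm (g : geometry) (c : R -> vec) (s0 eta d x y : R) :
  regular_arc g c s0 eta d -> Rabs (x - s0) < eta -> Rabs (y - s0) < eta -> x <> y ->
  tangent_point g c x y = tangent_point g c y x.
Proof.
  intros A Hx Hy Hxy.
  destruct (tangent_ratio_bounds g c s0 eta d x y A Hx Hy Hxy) as (_ & Px & _).
  destruct (tangent_ratio_bounds g c s0 eta d y x A Hy Hx (not_eq_sym Hxy))
    as (_ & Py & _).
  unfold tangent_point, tangent_ratio.
  set (p := dot (velocity c x) (normal c y)) in *.
  set (q := dot (velocity c y) (normal c x)) in *.
  assert (Hp : p <> 0) by (intros E; rewrite E in Px; lra).
  assert (Hq : q <> 0) by (intros E; rewrite E in Py; lra).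
  assert (Hk : 0 < - q / p).
  { replace (- q / p) with (d * ((y - x) * q) / (d * ((x - y) * p))).
    - now apply Rdiv_lt_0_compat.
    - field. repeat split; try lra. intros ->. lra. }
  rewrite <- (normalize_scal _ _ (minus (c y) _) Hk). f_equal.
  apply vec_ext. intros i.
  rewrite coord_scal, !coord_minus, !coord_scal.
  field_simplify_eq; [|split; assumption].
  unfold p, q, normal. clear. destruct i as [|[|i]]; vec_ring.
Qed.

(** If v3 <= 0, positivity of [polar (-1) x v] and the Cauchy-Schwarz inequality bound (x3 v3)^2 by
    x3^2 (v1^2 + v2^2), against v being timelike. This selects the upper sheet. *)
Lemma Hyperbolic_future (x v : vec) :
  Sigma Hyperbolic x -> 0 < polar (-1) x v -> 0 < polar (-1) v v -> 0 < coord v 2.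
Proof.
  destruct x as [[x1 x2] x3], v as [[v1 v2] v3]. unfold Sigma, polar; simpl.
  intros [H1 H2] H3 H4. apply Rnot_le_lt. intros H5.
  assert (C : (x1 * v1 + x2 * v2) ^ 2 <= (x1 ^ 2 + x2 ^ 2) * (v1 ^ 2 + v2 ^ 2)).
  { pose proof (pow2_ge_0 (x1 * v2 - x2 * v1)). nra. }
  assert (C1 : (x3 * v3) ^ 2 <= (x1 * v1 + x2 * v2) ^ 2).
  { assert (x3 * v3 <= 0) by nra. nra. }
  assert (0 <= v1 ^ 2 + v2 ^ 2) by nra.
  assert (C2 : (x1 ^ 2 + x2 ^ 2) * (v1 ^ 2 + v2 ^ 2) <= x3 ^ 2 * (v1 ^ 2 + v2 ^ 2)) by nra.
  assert (C3 : x3 ^ 2 * (v1 ^ 2 + v2 ^ 2) < x3 ^ 2 * v3 ^ 2) by nra.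
  nra.
Qed.

Lemma polar_normalize (e : R) (v : vec) :
  0 < polar e v v -> polar e (normalize e v) (normalize e v) = 1.
Proof.
  intros H. unfold normalize. set (k := / sqrt (polar e v v)).
  replace (polar e (scal k v) (scal k v)) with (k ^ 2 * polar e v v) by vec_ring.
  pose proof (sqrt_lt_R0 _ H). rewrite <- (sqrt_sqrt (polar e v v)) by lra.
  unfold k. field. lra.
Qed.

Lemma Sigma_tangent_point (g : geometry) (c : R -> vec) (s0 eta d x y : R) :
  regular_arc g c s0 eta d -> Rabs (x - s0) < eta -> Rabs (y - s0) < eta -> x <> y ->
  Sigma g (tangent_point g c x y).
Proof.
  intros A Hx Hy Hxy.
  pose proof (polar_tangent_vector_pos g c s0 eta d x y A Hx Hy Hxy) as Hv.
  cbv zeta in Hv. pose proof (polar_normalize _ _ Hv) as Hn.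
  pose proof (arc_Sigma _ _ _ _ _ x A Hx) as S.
  pose proof (arc_tangent _ _ _ _ _ _ A Hx) as T.
  fold (tangent_point g c x y) in Hn.
  destruct g.
  - unfold Sigma in S |- *. cbv zeta in S |- *. unfold tangent_point, normalize.
    rewrite coord_scal, (polar_tangent_vector _ c s0 eta d) by assumption.
    rewrite coord_minus, coord_scal.
    assert (V : coord (velocity c x) 2 = 0).
    { unfold polar in T. rewrite S in T. simpl curv in T. lra. }
    rewrite V, S. simpl curv. rewrite Rmult_0_l, Rplus_0_r, sqrt_1. field.
  - unfold Sigma. cbv zeta. rewrite <- Hn. unfold polar. simpl curv. ring.
  - split.
    + cbv zeta. unfold polar in Hn. simpl curv in Hn. lra.
    + unfold tangent_point, normalize. rewrite coord_scal.
      apply Rmult_lt_0_compat; [apply Rinv_0_lt_compat, sqrt_lt_R0, Hv|].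
      apply (Hyperbolic_future (c x)); [assumption| |exact Hv].
      replace (polar (-1) (c x) _) with (polar (-1) (c x) (c x)
        - tangent_ratio c x y * polar (-1) (c x) (velocity c x)) by vec_ring.
      simpl curv in T. rewrite T.
      pose proof (Sigma_polar _ _ S) as E. simpl curv in E. lra.
Qed.

Lemma geodesic_tangent_point (g : geometry) (c : R -> vec) (s0 eta d x y : R) :
  regular_arc g c s0 eta d -> Rabs (x - s0) < eta -> Rabs (y - s0) < eta -> x <> y ->
  geodesic g (c x) (velocity c x) (tangent_point g c x y).
Proof.
  intros A Hx Hy Hxy. split; [now apply (Sigma_tangent_point g c s0 eta d)|].
  unfold tangent_point, normalize. set (k := / sqrt _).
  exists k, (- (k * tangent_ratio c x y)). apply vec_ext. intros i.
  rewrite coord_scal, coord_minus, coord_plus, !coord_scal. ring.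
Qed.

Lemma segment_length_tangent_point (g : geometry) (c : R -> vec) (s0 eta d x y : R) :
  regular_arc g c s0 eta d -> Rabs (x - s0) < eta -> Rabs (y - s0) < eta -> x <> y ->
  segment_length g (c x) (tangent_point g c x y)
  = arctan_curv (curv g) (Rabs (tangent_ratio c x y) * speed g c x).
Proof.
  intros A Hx Hy Hxy.
  pose proof (polar_tangent_vector_pos g c s0 eta d x y A Hx Hy Hxy) as Hv.
  cbv zeta in Hv. pose proof (sqrt_lt_R0 _ Hv) as Hs. apply Rinv_0_lt_compat in Hs.
  pose proof (arc_Sigma _ _ _ _ _ x A Hx) as S.
  pose proof (arc_tangent _ _ _ _ _ _ A Hx) as T.
  set (k := / sqrt _) in Hs.
  assert (HP : polar (curv g) (c x) (tangent_point g c x y) = k).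
  { unfold tangent_point, normalize. fold k.
    replace (polar _ _ _) with (k * (polar (curv g) (c x) (c x)
      - tangent_ratio c x y * polar (curv g) (c x) (velocity c x))) by vec_ring.
    rewrite T, (Sigma_polar _ _ S). ring. }
  rewrite segment_length_eq; [|assumption| |].
  - rewrite HP. f_equal.
    replace (metric _ _ _) with ((k * tangent_ratio c x y) ^ 2
      * metric (curv g) (normal c x) (normal c x)).
    2:{ unfold tangent_point, normalize. fold k. unfold normal. vec_ring. }
    rewrite (metric_normal g c s0 eta d), <- (speed_sqr g c s0 eta d) by assumption.
    rewrite <- Rpow_mult_distr, <- Rsqr_pow2, sqrt_Rsqr_abs, !Rabs_mult.
    rewrite (Rabs_pos_eq k), (Rabs_pos_eq (speed g c x)).
    + field. lra.
    + apply Rlt_le. now apply (speed_pos g c s0 eta d).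
    + lra.
  - now apply (Sigma_tangent_point g c s0 eta d).
  - now rewrite HP.
Qed.

Lemma string_defect_eq (g : geometry) (c : R -> vec) (s0 eta d x y : R) :
  regular_arc g c s0 eta d -> Rabs (x - s0) < eta -> Rabs (y - s0) < eta -> y < x ->
  string_defect g c x y (tangent_point g c x y) = defect g c x y.
Proof.
  intros A Hx Hy Hxy. unfold string_defect, defect.
  rewrite (segment_length_tangent_point g c s0 eta d) by (try assumption; lra).
  rewrite (tangent_point_comm g c s0 eta d) by (try assumption; lra).
  rewrite (segment_length_tangent_point g c s0 eta d) by (try assumption; lra).
  destruct (tangent_length_bounds g c s0 eta d x y A Hx Hy Hxy) as (H1 & H2 & _).
  pose proof (tangent_length_lt_1 g c s0 eta d y x A Hy Hx ltac:(lra)).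
  pose proof (speed_pos g c s0 eta d x A Hx). pose proof (speed_pos g c s0 eta d y A Hy).
  rewrite (Rabs_pos_eq (tangent_ratio c x y)) by nra.
  rewrite (Rabs_left (tangent_ratio c y x)) by nra.
  rewrite Ropp_mult_distr_l_reverse, arctan_curv_opp by (assumption || apply curv_bounds).
  unfold curve_length. unfold Rminus. do 2 f_equal.
  apply RInt_ext. intros s _. now rewrite form_Q.
Qed.

(** * First variation of the string defect *)

Definition frame_det (c : R -> vec) (s : R) : R := dot (normal c s) (accel c s).

Definition cross_norm (g : geometry) (c : R -> vec) (x y : R) : R :=
  polar (curv g) (cross (normal c x) (normal c y)) (cross (normal c x) (normal c y)).

(** By [polar_cross_cross], [cross_norm] is (u(x) u(y))^2 - G^2 with G the metric product of the
    normals. Where it is positive, the factor (u(x) u(y) - G) / [cross_norm] is 1 / (u(x) u(y) + G),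
    symmetric in x and y. *)
Definition defect_slope (g : geometry) (c : R -> vec) (x y : R) : R :=
  frame_det c x * dot (c x) (normal c y)
  * (speed g c x * speed g c y - metric (curv g) (normal c x) (normal c y))
  / (cross_norm g c x y * speed g c x).

Lemma cross_norm_sym (g : geometry) (c : R -> vec) (x y : R) :
  cross_norm g c x y = cross_norm g c y x.
Proof. unfold cross_norm. vec_ring. Qed.

(** The right side is the denominator in the derivative of [arctan_curv] of a tangent length. As
    [cross_norm] is symmetric, both tangent lengths yield the same denominator. *)
Lemma cross_norm_eq (g : geometry) (c : R -> vec) (s0 eta d x y : R) :
  regular_arc g c s0 eta d -> Rabs (x - s0) < eta ->
  cross_norm g c x y = dot (velocity c x) (normal c y) ^ 2
    + curv g * (dot (c x) (normal c y) * speed g c x) ^ 2.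
Proof.
  intros A Hx. rewrite cross_norm_sym. unfold cross_norm.
  pose proof (arc_Sigma _ _ _ _ _ x A Hx) as S.
  pose proof (arc_tangent _ _ _ _ _ _ A Hx) as T.
  unfold normal at 2 4. rewrite polar_norm_triple.
  rewrite (Sigma_polar g _ S), (polar_tangent g (c x) _ S T), T.
  rewrite Rpow_mult_distr, (speed_sqr _ _ _ _ _ _ A Hx). ring.
Qed.

Lemma cross_norm_pos (g : geometry) (c : R -> vec) (s0 eta d x y : R) :
  regular_arc g c s0 eta d -> Rabs (x - s0) < eta -> Rabs (y - s0) < eta -> x <> y ->
  0 < cross_norm g c x y.
Proof.
  intros A Hx Hy Hxy. rewrite (cross_norm_eq g c s0 eta d) by assumption.
  destruct (tangent_ratio_bounds g c s0 eta d x y A Hx Hy Hxy) as (_ & Px & _).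
  set (p := dot (velocity c x) (normal c y)) in *.
  assert (Hp : p <> 0) by (intros E; rewrite E in Px; lra).
  pose proof (tangent_length_lt_1 g c s0 eta d x y A Hx Hy Hxy) as H.
  apply (one_plus_curv_pos (curv g)) in H; [|apply curv_bounds].
  unfold tangent_ratio in H. fold p in H.
  replace (_ + _) with (p ^ 2 * (1 + curv g *
    (dot (c x) (normal c y) / p * speed g c x) ^ 2)) by (field; assumption).
  apply Rmult_lt_0_compat; [|assumption]. now apply pow2_gt_0.
Qed.

(** A strict Cauchy-Schwarz inequality, read off from [cross_norm] > 0; it holds even though the
    form on normals is indefinite in the hyperbolic case. *)
Lemma metric_normal_lt (g : geometry) (c : R -> vec) (s0 eta d x y : R) :
  regular_arc g c s0 eta d -> Rabs (x - s0) < eta -> Rabs (y - s0) < eta -> x <> y ->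
  metric (curv g) (normal c x) (normal c y) < speed g c x * speed g c y.
Proof.
  intros A Hx Hy Hxy. pose proof (cross_norm_pos g c s0 eta d x y A Hx Hy Hxy) as H.
  unfold cross_norm in H. rewrite polar_cross_cross in H.
  rewrite !(metric_normal g c s0 eta d), <- !(speed_sqr g c s0 eta d) in H by assumption.
  pose proof (Rmult_lt_0_compat _ _ (speed_pos g c s0 eta d x A Hx)
    (speed_pos g c s0 eta d y A Hy)).
  rewrite <- Rpow_mult_distr in H. nra.
Qed.

Lemma frame_det_sign (g : geometry) (c : R -> vec) (s0 eta d x : R) :
  regular_arc g c s0 eta d -> Rabs (x - s0) < eta -> 0 < d * frame_det c x.
Proof.
  intros A Hx. unfold frame_det. replace (dot _ _) with (dot (accel c x) (normal c x)).
  - now apply (arc_convex _ _ _ _ _ A).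
  - vec_ring.
Qed.

Lemma defect_slope_pos (g : geometry) (c : R -> vec) (s0 eta d x y : R) :
  regular_arc g c s0 eta d -> Rabs (x - s0) < eta -> Rabs (y - s0) < eta -> x <> y ->
  0 < defect_slope g c x y.
Proof.
  intros A Hx Hy Hxy. unfold defect_slope.
  pose proof (cross_norm_pos g c s0 eta d x y A Hx Hy Hxy).
  pose proof (metric_normal_lt g c s0 eta d x y A Hx Hy Hxy).
  pose proof (frame_det_sign g c s0 eta d x A Hx).
  pose proof (speed_pos g c s0 eta d x A Hx).
  destruct (tangent_ratio_bounds g c s0 eta d x y A Hx Hy Hxy) as (H3 & _).
  apply Rdiv_lt_0_compat; [|now apply Rmult_lt_0_compat].
  apply Rmult_lt_0_compat; [|lra].
  assert (0 < (d * frame_det c x) * (d * dot (c x) (normal c y)))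
    by now apply Rmult_lt_0_compat.
  nra.
Qed.

Lemma is_derive_arctan_quotient (e : R) (p q u : R -> R) (x dp dq du : R) :
  -1 <= e -> is_derive p x dp -> is_derive q x dq -> is_derive u x du ->
  q x <> 0 -> -1 < p x / q x * u x < 1 ->
  is_derive (fun x => arctan_curv e (p x / q x * u x)) x
    (((dp * u x + p x * du) * q x - p x * u x * dq)
      / (q x ^ 2 + e * (p x * u x) ^ 2)).
Proof.
  intros He Hp Hq Hu Hn Hr.
  eapply is_derive_value.
  - apply (is_derive_comp (arctan_curv e) (fun x => p x / q x * u x)).
    + now apply is_derive_arctan_curv.
    + apply is_derive_Rmult; [|exact Hu].
      apply (is_derive_div p q x dp dq Hp Hq Hn).
  - pose proof (one_plus_curv_pos e _ He Hr) as H.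
    assert (q x ^ 2 + e * (p x * u x) ^ 2 <> 0).
    { replace (q x ^ 2 + e * (p x * u x) ^ 2)
        with (q x ^ 2 * (1 + e * (p x / q x * u x) ^ 2)) by (field; assumption).
      apply Rmult_integral_contrapositive_currified; [now apply pow_nonzero|lra]. }
    unfold scal; simpl. unfold mult; simpl. field. repeat split; try assumption.
    simpl in *; lra.
Qed.

Lemma is_derive_defect (g : geometry) (c : R -> vec) (s0 eta d x y : R) :
  regular_arc g c s0 eta d -> Rabs (x - s0) < eta -> Rabs (y - s0) < eta -> x <> y ->
  is_derive (fun x => defect g c x y) x (defect_slope g c x y).
Proof.
  intros A Hx Hy Hxy.
  destruct (tangent_ratio_bounds g c s0 eta d x y A Hx Hy Hxy) as (_ & Px & _).
  destruct (tangent_ratio_bounds g c s0 eta d y x A Hy Hx (not_eq_sym Hxy))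
    as (_ & Py & _).
  pose proof (cross_norm_pos g c s0 eta d x y A Hx Hy Hxy) as HN.
  pose proof (speed_pos g c s0 eta d x A Hx) as Hu.
  pose proof (arc_derive _ _ _ _ _ x A Hx) as D1.
  pose proof (arc_derive2 _ _ _ _ _ x A Hx) as D2.
  pose proof (is_vderive_normal _ _ _ _ _ _ A Hx) as D3.
  unfold defect, tangent_ratio.
  eapply is_derive_value.
  { apply is_derive_Rminus; [apply is_derive_Rminus|].
    - apply (is_derive_arctan_quotient _ (fun x => dot (c x) (normal c y))
        (fun x => dot (velocity c x) (normal c y)) (speed g c)).
      + apply curv_bounds.
      + apply is_derive_dot; [exact D1|apply is_vderive_const].
      + apply is_derive_dot; [exact D2|apply is_vderive_const].
      + now apply (is_derive_speed g c s0 eta d).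
      + intros E. rewrite E in Px. lra.
      + now apply (tangent_length_lt_1 g c s0 eta d).
    - eapply (is_derive_arctan_quotient _ (fun x => dot (c y) (normal c x))
        (fun x => dot (velocity c y) (normal c x)) (fun _ => speed g c y) x _ _ 0).
      + apply curv_bounds.
      + apply is_derive_dot; [apply is_vderive_const|exact D3].
      + apply is_derive_dot; [apply is_vderive_const|exact D3].
      + apply (is_derive_const (speed g c y)).
      + intros E. rewrite E in Py. lra.
      + now apply (tangent_length_lt_1 g c s0 eta d y x A Hy Hx (not_eq_sym Hxy)).
    - apply (is_derive_RInt (speed g c) _ y).
      + apply (locally_of_radius s0 eta); [assumption|]. intros z Hz.
        apply (RInt_correct (speed g c)), (ex_RInt_continuous (speed g c)).
        intros s Hs. apply (speed_continuous g c s0 eta d); [assumption|].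
        now apply (Rabs_between s0 eta z y).
      + now apply (speed_continuous g c s0 eta d). }
  cbv beta.
  rewrite <- (cross_norm_eq g c s0 eta d x y), <- (cross_norm_eq g c s0 eta d y x),
    (cross_norm_sym g c y x) by assumption.
  unfold defect_slope.
  replace (dot (velocity c x) (normal c y) + dot (c x) zero)
    with (dot (velocity c x) (normal c y)) by vec_ring.
  replace (dot (accel c x) (normal c y) + dot (velocity c x) zero)
    with (dot (accel c x) (normal c y)) by vec_ring.
  replace (dot zero (normal c x) + dot (c y) (cross (c x) (accel c x)))
    with (dot (c y) (cross (c x) (accel c x))) by vec_ring.
  replace (dot zero (normal c x) + dot (velocity c y) (cross (c x) (accel c x)))
    with (dot (velocity c y) (cross (c x) (accel c x))) by vec_ring.
  pose proof (dot_cross_wronskian (c x) (velocity c x) (accel c x) (c y) (velocity c y))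
    as W.
  pose proof (polar_cross_frenet (curv g) (c x) (velocity c x) (accel c x) (normal c y))
    as F.
  pose proof (cross_norm_eq g c s0 eta d x y A Hx) as N.
  fold (normal c x) in W, F. fold (normal c y) in W. fold (frame_det c x) in W, F.
  pose proof (arc_Sigma _ _ _ _ _ x A Hx) as S.
  pose proof (arc_tangent _ _ _ _ _ _ A Hx) as T.
  unfold normal at 3 in F.
  rewrite polar_cross_triple, (Sigma_polar g _ S), T, (arc_accel _ _ _ _ _ _ A Hx),
    (metric_normal _ _ _ _ _ _ A Hx), <- (speed_sqr _ _ _ _ _ _ A Hx) in F.
  set (K := cross_norm g c x y) in *. set (u := speed g c x) in *.
  set (uy := speed g c y) in *. set (D := frame_det c x) in *.
  set (a := dot (c x) (normal c y)) in *.
  set (a1 := dot (velocity c x) (normal c y)) in *.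
  set (a2 := dot (accel c x) (normal c y)) in *.
  set (b := dot (c y) (normal c x)) in *.
  set (b1 := dot (velocity c y) (normal c x)) in *.
  set (bn := dot (c y) (cross (c x) (accel c x))) in *.
  set (bn1 := dot (velocity c y) (cross (c x) (accel c x))) in *.
  set (G := metric (curv g) (normal c x) (normal c y)) in *.
  set (m := metric (curv g) (normal c x) (cross (c x) (accel c x))) in *.
  clearbody K u uy D a a1 a2 b b1 bn bn1 G m.
  (* Here K is [cross_norm]. Divided by it, u K becomes the speed u, which cancels against the
     derivative of the arc length; the remaining terms all contain D a. *)
  assert (E1 : (a1 * u + a * (m / u)) * a1 - a * u * a2 = u * K - D * a * G / u).
  { apply Rmult_eq_reg_l with u; [|lra].
    replace (u * ((a1 * u + a * (m / u)) * a1 - a * u * a2))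
      with (a1 ^ 2 * u ^ 2 + a * (m * a1 - u ^ 2 * a2)) by (field; lra).
    replace (m * a1 - u ^ 2 * a2) with (curv g * u ^ 4 * a - D * G) by lra.
    rewrite N. field. lra. }
  rewrite E1.
  replace ((bn * uy + b * 0) * b1 - b * uy * bn1) with (uy * (bn * b1 - b * bn1)) by ring.
  rewrite W. field. lra.
Qed.

Lemma defect_antisym (g : geometry) (c : R -> vec) (s0 eta d x y : R) :
  regular_arc g c s0 eta d -> Rabs (x - s0) < eta -> Rabs (y - s0) < eta ->
  defect g c y x = - defect g c x y.
Proof.
  intros A Hx Hy. unfold defect.
  rewrite <- (opp_RInt_swap (speed g c) y x).
  - unfold opp; simpl. ring.
  - apply (ex_RInt_continuous (speed g c)).
    intros s Hs. apply (speed_continuous g c s0 eta d); [assumption|].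
    now apply (Rabs_between s0 eta x y).
Qed.

Lemma is_derive_defect_r (g : geometry) (c : R -> vec) (s0 eta d x y : R) :
  regular_arc g c s0 eta d -> Rabs (x - s0) < eta -> Rabs (y - s0) < eta -> x <> y ->
  is_derive (fun y => defect g c x y) y (- defect_slope g c y x).
Proof.
  intros A Hx Hy Hxy.
  apply (is_derive_ext_loc (fun y => - defect g c y x)).
  - apply (locally_of_radius s0 eta); [assumption|]. intros z Hz.
    symmetry. now apply (defect_antisym g c s0 eta d).
  - apply (is_derive_opp (fun y => defect g c y x)).
    apply (is_derive_defect g c s0 eta d); auto.
Qed.

(** * Sign and size of the string defect *)

Lemma speed_RInt_bounds (g : geometry) (c : R -> vec) (s0 eta d x y : R) :
  regular_arc g c s0 eta d -> Rabs (x - s0) < eta -> Rabs (y - s0) < eta -> y < x ->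
  0 <= RInt (speed g c) y x <= / (4 * eta) * (x - y).
Proof.
  intros A Hx Hy Hxy.
  assert (He : 0 < eta) by (pose proof (Rabs_pos (x - s0)); lra).
  assert (Hz : forall z, y <= z <= x -> Rabs (z - s0) < eta).
  { intros z Hz. apply (Rabs_between s0 eta x y); [assumption..|].
    rewrite Rmin_left, Rmax_right; lra. }
  assert (Hi : ex_RInt (speed g c) y x).
  { apply (ex_RInt_continuous (speed g c)). intros z Hz'.
    rewrite Rmin_left, Rmax_right in Hz' by lra.
    apply (speed_continuous g c s0 eta d); auto. }
  split.
  - apply RInt_ge_0; [lra|assumption|]. intros z _. apply sqrt_pos.
  - replace (/ (4 * eta) * (x - y)) with (RInt (fun _ => / (4 * eta)) y x).
    + apply RInt_le; [lra|assumption|apply ex_RInt_const|]. intros z Hz'.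
      pose proof (arc_short _ _ _ _ _ A z (Hz z ltac:(lra))).
      apply Rmult_le_reg_l with (4 * eta); [lra|]. rewrite Rinv_r by lra. lra.
    + rewrite RInt_const. unfold scal; simpl; unfold mult; simpl. ring.
Qed.

Lemma defect_increasing (g : geometry) (c : R -> vec) (s0 eta d x y z : R) :
  regular_arc g c s0 eta d -> Rabs (x - s0) < eta -> Rabs (y - s0) < eta ->
  y < z < x -> defect g c z y < defect g c x y.
Proof.
  intros A Hx Hy Hz.
  assert (Hs : forall s, z <= s <= x -> Rabs (s - s0) < eta).
  { intros s Hs. apply (Rabs_between s0 eta x y); [assumption..|].
    rewrite Rmin_left, Rmax_right; lra. }
  destruct (MVT_cor2 (fun x => defect g c x y) (fun x => defect_slope g c x y) z x)
    as (w & E & Hw).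
  - lra.
  - intros w Hw. apply is_derive_Reals.
    apply (is_derive_defect g c s0 eta d); auto; lra.
  - pose proof (defect_slope_pos g c s0 eta d w y A (Hs w ltac:(lra)) Hy ltac:(lra)).
    nra.
Qed.

(** Positivity comes from monotonicity in the first argument together with a lower bound that tends
    to 0 on the diagonal, so the arc is never compared with its tangents. The upper bound combines x
    - y < 2 eta with 8 eta u <= r at both endpoints. *)
Lemma defect_bounds (g : geometry) (c : R -> vec) (s0 eta d x y r : R) :
  regular_arc g c s0 eta d -> Rabs (x - s0) < eta -> Rabs (y - s0) < eta -> y < x ->
  (forall s, Rabs (s - s0) < eta -> 8 * eta * speed g c s <= r) ->
  0 < defect g c x y < r.
Proof.
  intros A Hx Hy Hxy Hr.
  assert (He : 0 < eta) by (pose proof (Rabs_pos (x - s0)); lra).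
  assert (L : forall z, y < z <= x -> - RInt (speed g c) y z <= defect g c z y
    <= 2 * (z - y) * (speed g c z + speed g c y) /\ Rabs (z - s0) < eta).
  { intros z Hz.
    assert (Hzs : Rabs (z - s0) < eta).
    { apply (Rabs_between s0 eta x y); [assumption..|].
      rewrite Rmin_left, Rmax_right; lra. }
    destruct (tangent_length_bounds g c s0 eta d z y A Hzs Hy ltac:(lra))
      as (H1 & H2 & H3 & H4).
    pose proof (tangent_length_lt_1 g c s0 eta d y z A Hy Hzs ltac:(lra)).
    pose proof (speed_RInt_bounds g c s0 eta d z y A Hzs Hy ltac:(lra)).
    pose proof (curv_bounds g) as [Hc _].
    pose proof (arctan_curv_bounds (curv g) (tangent_ratio c z y * speed g c z) Hc
      ltac:(lra)).
    pose proof (arctan_curv_bounds (curv g) (- tangent_ratio c y z * speed g c y) Hc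
      ltac:(lra)) as B.
    rewrite Ropp_mult_distr_l_reverse, arctan_curv_opp in B by assumption.
    split; [|assumption]. unfold defect. lra. }
  split.
  - set (m := (x + y) / 2).
    assert (Hm : y < m < x) by (unfold m; lra). clearbody m.
    apply Rle_lt_trans with (defect g c m y).
    2:{ apply (defect_increasing g c s0 eta d); auto. }
    apply Rnot_lt_le. intros Hneg.
    (* The speed is at most 1 / (4 eta), so the arc from y to z is at most half of -
       [defect g c m y]. Then the defect at z exceeds the one at m although z <= m. *)
    set (z := Rmin m (y + - defect g c m y * (2 * eta))).
    assert (y < z <= m) as Hz.
    { split; [|apply Rmin_l]. apply Rmin_glb_lt; [lra|].
      assert (0 < - defect g c m y * (2 * eta)) by (apply Rmult_lt_0_compat; lra). lra. }
    assert (Hz2 : z <= y + - defect g c m y * (2 * eta)) by apply Rmin_r.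
    destruct (L z) as [[H1 _] Hzs]; [lra|].
    pose proof (speed_RInt_bounds g c s0 eta d z y A Hzs Hy ltac:(lra)) as [_ H2].
    assert (H3 : / (4 * eta) * (z - y) <= - defect g c m y / 2).
    { apply Rmult_le_reg_l with (4 * eta); [lra|].
      replace (4 * eta * (/ (4 * eta) * (z - y))) with (z - y) by (field; lra). lra. }
    destruct (Req_dec z m) as [Hzm|Hzm].
    + rewrite Hzm in H1, H2, H3. lra.
    + assert (defect g c z y < defect g c m y).
      { apply (defect_increasing g c s0 eta d); auto; [|lra].
        apply L. lra. }
      lra.
  - destruct (L x) as [[_ H1] _]; [lra|].
    pose proof (Hr x Hx). pose proof (Hr y Hy).
    pose proof (speed_pos g c s0 eta d x A Hx). pose proof (speed_pos g c s0 eta d y A Hy).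
    apply Rabs_def2 in Hx. apply Rabs_def2 in Hy. nra.
Qed.

(** * Germs with non-zero geodesic curvature *)

Lemma Ck_near_2_derive (f : R -> R) (s0 : R) :
  Ck_near 2 f s0 -> locally s0 (fun s => is_derive f s (Derive f s)
    /\ is_derive (Derive f) s (Derive (Derive f) s)
    /\ continuous (Derive (Derive f)) s).
Proof.
  unfold Ck_near. apply filter_imp. intros s [H1 H2]. split; [|split].
  - apply Derive_correct. apply (H1 1%nat). lia.
  - apply Derive_correct. apply (H1 2%nat). lia.
  - exact H2.
Qed.

Lemma exists_C2_arc (g : geometry) (c : R -> vec) (s0 : R) :
  C2_curve_germ g c s0 ->
  (exists eta, 0 < eta /\ C2_arc g c s0 eta)
  /\ forall i, continuous (fun s => coord (accel c s) i) s0.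
Proof.
  intros (HC & HS & _).
  pose proof (Ck_near_2_derive _ _ (HC 0%nat ltac:(lia))) as H0.
  pose proof (Ck_near_2_derive _ _ (HC 1%nat ltac:(lia))) as H1.
  pose proof (Ck_near_2_derive _ _ (HC 2%nat ltac:(lia))) as H2.
  split.
  - destruct (filter_and _ _ HS (filter_and _ _ H0 (filter_and _ _ H1 H2))) as [r Hr].
    exists r. split; [apply cond_pos|].
    split; intros s Hs; destruct (Hr s Hs) as (S & (A1 & A2 & _) & (B1 & B2 & _)
      & D1 & D2 & _); [| |exact S]; intros [|[|i]]; assumption.
  - intros [|[|i]].
    + apply (locally_singleton _ _ H0).
    + apply (locally_singleton _ _ H1).
    + apply (locally_singleton _ _ H2).
Qed.

(** For e = 1 and e = -1 this is the Gram determinant of x, v, w for [polar], whose own determinant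
    is e^2 = 1. That determinant vanishes for e = 0, where coordinates are used. *)
Lemma tangent_gram (g : geometry) (x v w : vec) :
  Sigma g x -> polar (curv g) x v = 0 -> polar (curv g) x w = 0 ->
  dot (cross x v) w ^ 2
  = metric (curv g) v v * metric (curv g) w w - metric (curv g) v w ^ 2.
Proof.
  intros Hx Hv Hw. pose proof (Sigma_polar g x Hx) as Px.
  destruct g; simpl curv in *.
  - destruct x as [[x1 x2] x3], v as [[v1 v2] v3], w as [[w1 w2] w3].
    unfold Sigma, polar in *; simpl in *. subst x3.
    replace v3 with 0 by lra. replace w3 with 0 by lra. vec_ring.
  - transitivity (polar 1 x x * (metric 1 v v * metric 1 w w - metric 1 v w ^ 2)
      - polar 1 x v * (polar 1 x v * polar 1 w w - polar 1 v w * polar 1 x w)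
      + polar 1 x w * (polar 1 x v * polar 1 v w - polar 1 v v * polar 1 x w)).
    + vec_ring.
    + rewrite Px, Hv, Hw. ring.
  - transitivity (polar (-1) x x
        * (metric (-1) v v * metric (-1) w w - metric (-1) v w ^ 2)
      - polar (-1) x v * (polar (-1) x v * polar (-1) w w - polar (-1) v w * polar (-1) x w)
      + polar (-1) x w * (polar (-1) x v * polar (-1) v w - polar (-1) v v * polar (-1) x w)).
    + vec_ring.
    + rewrite Px, Hv, Hw. ring.
Qed.

(** Subtracting multiples of c and c' from c'' leaves the determinant unchanged. If it is zero, the
    normal component n of the acceleration is both orthogonal to c' and dependent on it in the
    tangent plane, so [tangent_gram] gives it length 0. *)
Lemma frame_det_neq_0 (g : geometry) (c : R -> vec) (s0 eta : R) :
  0 < eta -> C2_arc g c s0 eta -> velocity c s0 <> zero ->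
  geodesic_curvature g c s0 <> 0 -> frame_det c s0 <> 0.
Proof.
  intros He A Hv Hk HD. apply Hk. clear Hk.
  assert (Hs : Rabs (s0 - s0) < eta) by now rewrite Rminus_diag, Rabs_R0.
  pose proof (C2_Sigma _ _ _ _ A s0 Hs) as S.
  pose proof (C2_tangent _ _ _ _ _ A Hs) as T.
  pose proof (C2_accel _ _ _ _ _ A Hs) as TA.
  pose proof (metric_tangent_pos g _ _ S T Hv) as Hp.
  unfold geodesic_curvature. rewrite !form_Q.
  set (v := velocity c s0) in *. set (w := covariant_acceleration g c s0).
  assert (Hw : polar (curv g) (c s0) w = 0
    /\ dot (cross (c s0) v) w = 0).
  { unfold frame_det, normal in HD. fold v in HD.
    unfold w, covariant_acceleration. fold (accel c s0).
    destruct g; simpl curv in *.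
    - split; [lra|exact HD].
    - rewrite !form_Q. simpl curv. set (k := _ / _). split.
      + replace (polar 1 _ _) with (polar 1 (c s0) (accel c s0)
          - k * polar 1 (c s0) (c s0)) by vec_ring.
        unfold k.
        replace (metric 1 (accel c s0) (c s0)) with (polar 1 (c s0) (accel c s0))
          by vec_ring.
        replace (metric 1 (c s0) (c s0)) with (polar 1 (c s0) (c s0)) by vec_ring.
        pose proof (Sigma_polar _ _ S) as P. simpl curv in P. rewrite P. field.
      + rewrite <- HD. vec_ring.
    - rewrite !form_Q. simpl curv. set (k := _ / _). split.
      + replace (polar (-1) _ _) with (polar (-1) (c s0) (accel c s0)
          - k * polar (-1) (c s0) (c s0)) by vec_ring.
        unfold k.
        replace (metric (-1) (accel c s0) (c s0))
          with (- polar (-1) (c s0) (accel c s0)) by vec_ring.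
        replace (metric (-1) (c s0) (c s0)) with (- polar (-1) (c s0) (c s0)) by vec_ring.
        pose proof (Sigma_polar _ _ S) as P. simpl curv in P. rewrite P. field.
      + rewrite <- HD. vec_ring. }
  clearbody w. destruct Hw as [Hw1 Hw2].
  set (k := metric (curv g) w v / metric (curv g) v v).
  set (n := minus w (scal k v)).
  assert (Hn : metric (curv g) n n = 0).
  { apply Rmult_eq_reg_l with (metric (curv g) v v); [|lra].
    assert (metric (curv g) v n = 0).
    { replace (metric (curv g) v n) with
        (metric (curv g) w v - k * metric (curv g) v v) by (unfold n; vec_ring).
      unfold k. field. lra. }
    pose proof (tangent_gram g (c s0) v n S T) as G.
    replace (dot (cross (c s0) v) n) with (dot (cross (c s0) v) w) in G
      by (unfold n; vec_ring).
    rewrite Hw2, H in G. rewrite Rmult_0_r.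
    assert (polar (curv g) (c s0) n = 0).
    { replace (polar (curv g) (c s0) n) with
        (polar (curv g) (c s0) w - k * polar (curv g) (c s0) v) by (unfold n; vec_ring).
      rewrite Hw1, T. ring. }
    specialize (G H0). lra. }
  fold n. rewrite Hn, sqrt_0. unfold Rdiv. ring.
Qed.

(** * Joint continuity and the choice of the interval *)

Definition vcontinuous2 (f : R -> R -> vec) (x y : R) : Prop :=
  forall i, continuity_2d_pt (fun u v => coord (f u v) i) x y.

Lemma vcontinuous2_comp_l (f : R -> vec) (x y : R) :
  (forall i, continuous (fun s => coord (f s) i) x) -> vcontinuous2 (fun u _ => f u) x y.
Proof.
  intros H i. apply (continuity_1d_2d_pt_comp (fun s => coord (f s) i) (fun u _ => u)).
  - apply continuity_pt_filterlim, H.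
  - apply continuity_2d_pt_id1.
Qed.

Lemma vcontinuous2_comp_r (f : R -> vec) (x y : R) :
  (forall i, continuous (fun s => coord (f s) i) y) -> vcontinuous2 (fun _ v => f v) x y.
Proof.
  intros H i. apply (continuity_1d_2d_pt_comp (fun s => coord (f s) i) (fun _ v => v)).
  - apply continuity_pt_filterlim, H.
  - apply continuity_2d_pt_id2.
Qed.

Ltac continuity_2d_tac :=
  repeat match goal with
  | |- continuity_2d_pt (fun _ _ => _ - _) _ _ => apply continuity_2d_pt_minus
  | |- continuity_2d_pt (fun _ _ => _ + _) _ _ => apply continuity_2d_pt_plus
  | |- continuity_2d_pt (fun _ _ => _ * _) _ _ => apply continuity_2d_pt_mult
  | H : vcontinuous2 _ _ _ |- continuity_2d_pt (fun _ _ => coord _ _) _ _ => apply H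
  | |- _ => apply continuity_2d_pt_const
  end.

Lemma continuity_2d_dot (f h : R -> R -> vec) (x y : R) :
  vcontinuous2 f x y -> vcontinuous2 h x y ->
  continuity_2d_pt (fun u v => dot (f u v) (h u v)) x y.
Proof. intros Hf Hh. unfold dot. continuity_2d_tac. Qed.

Lemma continuity_2d_polar (e : R) (f h : R -> R -> vec) (x y : R) :
  vcontinuous2 f x y -> vcontinuous2 h x y ->
  continuity_2d_pt (fun u v => polar e (f u v) (h u v)) x y.
Proof. intros Hf Hh. unfold polar. continuity_2d_tac. Qed.

Lemma vderive_continuous (f : R -> vec) (s : R) (v : vec) (i : nat) :
  is_vderive f s v -> continuous (fun s => coord (f s) i) s.
Proof.
  intros H. apply (ex_derive_continuous (fun s => coord (f s) i)).
  now exists (coord v i).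
Qed.

Lemma vcontinuous2_ball (f : R -> R -> vec) (x y : R) (r : posreal) :
  vcontinuous2 f x y -> locally_2d (fun u v => ball (f x y) r (f u v)) x y.
Proof.
  intros H.
  pose proof (locally_2d_and _ _ _ _ (H 0%nat r)
    (locally_2d_and _ _ _ _ (H 1%nat r) (H 2%nat r))) as [e He].
  exists e. intros u v Hu Hv. destruct (He u v Hu Hv) as (H0 & H1 & H2).
  repeat split; assumption.
Qed.

(** The tangent ratio is a 0 / 0 quotient on the diagonal, so it is replaced by an independent
    variable k near 0. The bound of the ratio by |x - y| then brings [tangent_point] close to
    c(s). *)
Lemma vcontinuous2_tangent_vector (e : R) (c w : R -> vec) (s : R) :
  (forall i, continuous (fun s => coord (c s) i) s) ->
  (forall i, continuous (fun s => coord (w s) i) s) ->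
  polar e (c s) (c s) = 1 ->
  vcontinuous2 (fun k x => normalize e (minus (c x) (scal k (w x)))) 0 s.
Proof.
  intros Hc Hw Hp i.
  apply (vcontinuous2_comp_r c 0) in Hc. apply (vcontinuous2_comp_r w 0) in Hw.
  assert (H : vcontinuous2 (fun k x => minus (c x) (scal k (w x))) 0 s).
  { intros j. apply (continuity_2d_pt_ext
      (fun k x => coord (c x) j - k * coord (w x) j)).
    - intros k x. now rewrite coord_minus, coord_scal.
    - apply continuity_2d_pt_minus; [apply Hc|].
      apply continuity_2d_pt_mult; [apply continuity_2d_pt_id1|apply Hw]. }
  apply (continuity_2d_pt_ext (fun k x =>
    (fun z => / sqrt z) (polar e (minus (c x) (scal k (w x))) (minus (c x) (scal k (w x))))
    * coord (minus (c x) (scal k (w x))) i)).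
  { intros k x. symmetry. apply coord_scal. }
  apply continuity_2d_pt_mult; [|apply H].
  apply (continuity_1d_2d_pt_comp (fun z => / sqrt z)).
  - replace (polar e _ _) with 1 by (rewrite <- Hp; vec_ring).
    apply continuity_pt_filterlim, (ex_derive_continuous (fun z => / sqrt z)).
    auto_derive. rewrite sqrt_1. lra.
  - now apply continuity_2d_polar.
Qed.

Lemma exists_regular_arc (g : geometry) (c : R -> vec) (s0 : R) (delta : posreal) :
  C2_curve_germ g c s0 -> geodesic_curvature g c s0 <> 0 ->
  exists eta d, 0 < eta <= delta /\ regular_arc g c s0 eta d
    /\ (forall s, Rabs (s - s0) < eta -> 8 * eta * speed g c s <= delta)
    /\ (forall x y, Rabs (x - s0) < eta -> Rabs (y - s0) < eta -> x <> y ->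
        ball (c s0) delta (tangent_point g c x y)).
Proof.
  intros HC Hk. pose proof HC as (_ & _ & Hv).
  destruct (exists_C2_arc g c s0 HC) as [(eta0 & He0 & A) Hacc].
  pose proof (frame_det_neq_0 g c s0 eta0 He0 A Hv Hk) as HD.
  set (d := frame_det c s0) in *.
  assert (Hs : Rabs (s0 - s0) < eta0) by now rewrite Rminus_diag, Rabs_R0.
  pose proof (C2_derive _ _ _ _ A s0 Hs) as D1.
  pose proof (C2_derive2 _ _ _ _ A s0 Hs) as D2.
  pose proof (C2_Sigma _ _ _ _ A s0 Hs) as S.
  assert (Cn : vcontinuous2 (fun _ y => normal c y) s0 s0).
  { apply (vcontinuous2_comp_r (normal c)). intros i.
    eapply vderive_continuous. apply is_vderive_cross; [exact D1|exact D2]. }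
  pose proof (continuity_2d_dot _ _ _ _ (vcontinuous2_comp_l _ s0 s0 Hacc) Cn) as Cd.
  cbv beta in Cd.
  assert (Hd : 0 < Rabs d) by now apply Rabs_pos_lt.
  (* Within |d| of its value d at (s0, s0), the pairing <c''(x), n(y)> keeps the sign of d; d itself
     thus serves as the recorded side. *)
  destruct (Cd (mkposreal _ Hd)) as [r1 Hr1]. simpl in Hr1.
  replace (dot (accel c s0) (normal c s0)) with d in Hr1
    by (unfold d, frame_det; vec_ring).
  assert (Cs : continuous (speed g c) s0).
  { apply (continuous_comp (fun s => metric (curv g) (velocity c s) (velocity c s)) sqrt).
    - eapply (ex_derive_continuous
        (fun s => metric (curv g) (velocity c s) (velocity c s))).
      eexists. apply is_derive_metric; exact D2.
    - apply continuity_pt_filterlim, continuity_pt_sqrt, Rlt_le.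
      apply (metric_tangent_pos g (c s0)); [assumption| |assumption].
      now apply (C2_tangent g c s0 eta0). }
  destruct (Cs _ (locally_ball (speed g c s0) (mkposreal 1 Rlt_0_1))) as [r2 Hr2].
  pose proof (vcontinuous2_ball _ _ _ delta
    (vcontinuous2_tangent_vector (curv g) c (velocity c) s0
      (fun i => vderive_continuous _ _ _ i D1) (fun i => vderive_continuous _ _ _ i D2)
      (Sigma_polar g _ S))) as [r3 Hr3].
  cbv beta in Hr3.
  assert (E0 : normalize (curv g) (minus (c s0) (scal 0 (velocity c s0))) = c s0).
  { assert (Ev : minus (c s0) (scal 0 (velocity c s0)) = c s0) by vec_eq.
    rewrite Ev. unfold normalize. rewrite (Sigma_polar g _ S), sqrt_1, Rinv_1. vec_eq. }
  rewrite E0 in Hr3. clear E0.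
  set (U := speed g c s0 + 1).
  assert (HU : 0 < U) by (pose proof (sqrt_pos (metric (curv g) (velocity c s0)
    (velocity c s0))); unfold U, speed; lra).
  (* Here r1 gives convexity and r2 the bound U on the speed. The tangent ratio is below 2 m, hence
     r3 / 2; 1 / (5 U) gives 4 m u < 1 strictly, and delta / (8 U) gives 8 m u <= delta. *)
  set (m := Rmin (Rmin (Rmin eta0 delta) (Rmin r1 r2))
    (Rmin (r3 / 2) (Rmin (/ (5 * U)) (delta / (8 * U))))).
  assert (0 < m <= eta0 /\ m <= delta /\ m <= r1 /\ m <= r2 /\ m <= r3 / 2
    /\ m <= / (5 * U) /\ m <= delta / (8 * U))
    as ([Hm Hm0] & Hmd & Hm1 & Hm2 & Hm3 & Hm4 & Hm5).
  { pose proof (cond_pos delta). pose proof (cond_pos r1). pose proof (cond_pos r2).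
    pose proof (cond_pos r3).
    assert (0 < / (5 * U)) by (apply Rinv_0_lt_compat; lra).
    assert (0 < delta / (8 * U)) by (apply Rdiv_lt_0_compat; lra).
    pose proof (Rmin_l (Rmin (Rmin eta0 delta) (Rmin r1 r2))
      (Rmin (r3 / 2) (Rmin (/ (5 * U)) (delta / (8 * U))))) as L1.
    pose proof (Rmin_r (Rmin (Rmin eta0 delta) (Rmin r1 r2))
      (Rmin (r3 / 2) (Rmin (/ (5 * U)) (delta / (8 * U))))) as L2.
    fold m in L1, L2.
    pose proof (Rmin_l (Rmin eta0 delta) (Rmin r1 r2)).
    pose proof (Rmin_r (Rmin eta0 delta) (Rmin r1 r2)).
    pose proof (Rmin_l eta0 delta). pose proof (Rmin_r eta0 delta).
    pose proof (Rmin_l r1 r2). pose proof (Rmin_r r1 r2).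
    pose proof (Rmin_l (r3 / 2) (Rmin (/ (5 * U)) (delta / (8 * U)))).
    pose proof (Rmin_r (r3 / 2) (Rmin (/ (5 * U)) (delta / (8 * U)))).
    pose proof (Rmin_l (/ (5 * U)) (delta / (8 * U))).
    pose proof (Rmin_r (/ (5 * U)) (delta / (8 * U))).
    split; [split; [unfold m; repeat apply Rmin_pos; lra|lra]|]. repeat split; lra. }
  clearbody m.
  assert (Hu : forall s, Rabs (s - s0) < m -> speed g c s < U).
  { intros s Hsm. specialize (Hr2 s).
    assert (Hb : Rabs (speed g c s - speed g c s0) < 1)
      by (apply Hr2; change (Rabs (s - s0) < r2); lra).
    apply Rabs_def2 in Hb. unfold U. lra. }
  assert (AR : regular_arc g c s0 m d).
  { split.
    - destruct A as [A1 A2 A3].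
      split; intros s Hsm; [apply A1|apply A2|apply A3]; lra.
    - intros x y Hx Hy. specialize (Hr1 x y ltac:(lra) ltac:(lra)).
      set (z := dot _ _) in *.
      apply Rabs_def2 in Hr1. destruct (Rdichotomy _ _ HD) as [H|H].
      + rewrite Rabs_left in Hr1 by assumption. nra.
      + rewrite Rabs_pos_eq in Hr1 by lra. nra.
    - intros s Hsm. specialize (Hu s Hsm). pose proof (sqrt_pos
        (metric (curv g) (velocity c s) (velocity c s))) as Hp. fold (speed g c s) in Hp.
      apply Rmult_le_compat_r with (r := 5 * U) in Hm4; [|lra].
      rewrite Rinv_l in Hm4 by lra. nra. }
  exists m, d. split; [lra|]. split; [exact AR|]. split.
  - intros s Hsm. specialize (Hu s Hsm).
    apply Rmult_le_compat_r with (r := 8 * U) in Hm5; [|lra].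
    replace (delta / (8 * U) * (8 * U)) with (pos delta) in Hm5 by (field; lra). nra.
  - intros x y Hx Hy Hxy.
    destruct (tangent_ratio_bounds g c s0 m d x y AR Hx Hy Hxy) as (_ & _ & q & Hq & E).
    apply Hr3; [|lra]. rewrite E, Rminus_0_r, Rabs_mult, (Rabs_pos_eq q) by lra.
    assert (Rabs (x - y) < 2 * m).
    { apply Rabs_def2 in Hx. apply Rabs_def2 in Hy. apply Rabs_def1; lra. }
    pose proof (Rabs_pos (x - y)). nra.
Qed.

(** * The conic *)

(** Multiple of the normal that becomes the polar covector of the conic. *)
Definition covector (g : geometry) (c : R -> vec) (t : R -> R) (s : R) : vec :=
  scal (Derive t s * speed g c s / frame_det c s) (normal c s).

(** Pairs (x, b) and (a, y) with equal defect have equal t-differences, which puts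
    [level_set_slopes] in force with the two partial derivatives of the defect at (a, b). *)
Lemma covector_symmetric_lt (g : geometry) (c : R -> vec) (t : R -> R)
  (s0 eta d a b : R) :
  regular_arc g c s0 eta d ->
  (forall s, Rabs (s - s0) < eta -> ex_derive t s) ->
  (forall x y z w, Rabs (x - s0) < eta -> Rabs (y - s0) < eta ->
    Rabs (z - s0) < eta -> Rabs (w - s0) < eta -> y < x -> w < z ->
    defect g c x y = defect g c z w -> t x - t y = t z - t w) ->
  Rabs (a - s0) < eta -> Rabs (b - s0) < eta -> b < a ->
  dot (covector g c t a) (c b) = dot (covector g c t b) (c a).
Proof.
  intros A Dt Ht Ha Hb Hab.
  assert (Hab' : a <> b) by lra. pose proof (not_eq_sym Hab') as Hba.
  (* The bound (a - b) / 2 preserves the order of the endpoints, b < x and y < a; the other two stay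
     on the arc. *)
  set (r := Rmin ((a - b) / 2) (Rmin (eta - Rabs (a - s0)) (eta - Rabs (b - s0)))).
  assert (Hr : 0 < r) by (unfold r; repeat apply Rmin_pos; lra).
  assert (r <= (a - b) / 2 /\ r <= eta - Rabs (a - s0) /\ r <= eta - Rabs (b - s0))
    as (Hr1 & Hr2 & Hr3).
  { split; [apply Rmin_l|split]; (eapply Rle_trans; [apply Rmin_r|]);
      [apply Rmin_l|apply Rmin_r]. }
  clearbody r.
  assert (Hx : forall x, Rabs (x - a) < r -> Rabs (x - s0) < eta /\ b < x).
  { intros x Hx. split.
    - replace (x - s0) with ((x - a) + (a - s0)) by ring.
      eapply Rle_lt_trans; [apply Rabs_triang|lra].
    - apply Rabs_def2 in Hx. lra. }
  assert (Hy : forall y, Rabs (y - b) < r -> Rabs (y - s0) < eta /\ y < a).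
  { intros y Hy. split.
    - replace (y - s0) with ((y - b) + (b - s0)) by ring.
      eapply Rle_lt_trans; [apply Rabs_triang|lra].
    - apply Rabs_def2 in Hy. lra. }
  pose proof (level_set_slopes (fun x => defect g c x b) (fun y => defect g c a y) t a b
    (defect_slope g c a b) (- defect_slope g c b a) (Derive t a) (Derive t b) r
    (defect_slope_pos g c s0 eta d a b A Ha Hb Hab')
    (is_derive_defect g c s0 eta d a b A Ha Hb Hab')
    (is_derive_defect_r g c s0 eta d a b A Ha Hb Hab')
    (Derive_correct _ _ (Dt a Ha)) (Derive_correct _ _ (Dt b Hb)) eq_refl Hr) as E.
  assert (E' : Derive t a * - defect_slope g c b a
    + Derive t b * defect_slope g c a b = 0).
  { apply E.
    - intros x Hxr. destruct (Hx x Hxr). apply continuity_pt_filterlim.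
      apply (ex_derive_continuous (fun x => defect g c x b)). eexists.
      apply (is_derive_defect g c s0 eta d); auto. lra.
    - intros x y Hxr Hyr Exy. destruct (Hx x Hxr), (Hy y Hyr). now apply Ht. }
  clear E. unfold defect_slope in E'. rewrite (cross_norm_sym g c b a) in E'.
  pose proof (cross_norm_pos g c s0 eta d a b A Ha Hb Hab') as HN.
  pose proof (metric_normal_lt g c s0 eta d a b A Ha Hb Hab') as HG.
  replace (metric (curv g) (normal c b) (normal c a)) with
    (metric (curv g) (normal c a) (normal c b)) in E' by vec_ring.
  pose proof (speed_pos g c s0 eta d a A Ha) as Hua.
  pose proof (speed_pos g c s0 eta d b A Hb) as Hub.
  assert (HDa : frame_det c a <> 0).
  { intros H0. pose proof (frame_det_sign g c s0 eta d a A Ha). rewrite H0 in H. lra. }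
  assert (HDb : frame_det c b <> 0).
  { intros H0. pose proof (frame_det_sign g c s0 eta d b A Hb). rewrite H0 in H. lra. }
  unfold covector.
  replace (dot (scal _ (normal c a)) (c b)) with
    (Derive t a * speed g c a / frame_det c a * dot (c b) (normal c a)) by vec_ring.
  replace (dot (scal _ (normal c b)) (c a)) with
    (Derive t b * speed g c b / frame_det c b * dot (c a) (normal c b)) by vec_ring.
  set (G := metric _ _ _) in *. set (N := cross_norm g c a b) in *.
  set (ua := speed g c a) in *. set (ub := speed g c b) in *.
  set (Da := frame_det c a) in *. set (Db := frame_det c b) in *.
  (* The nonzero factor shared by both sides once each slope is written through the covectors. *)
  apply Rmult_eq_reg_r with (Da * Db * (ua * ub - G) / (N * ua * ub)).
  - apply Rminus_diag_uniq_sym. rewrite <- E'. field. repeat split; lra.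
  - apply Rmult_integral_contrapositive_currified.
    + repeat apply Rmult_integral_contrapositive_currified; lra.
    + apply Rinv_neq_0_compat.
      repeat apply Rmult_integral_contrapositive_currified; lra.
Qed.

Lemma covector_symmetric (g : geometry) (c : R -> vec) (t : R -> R) (s0 eta d a b : R) :
  regular_arc g c s0 eta d ->
  (forall s, Rabs (s - s0) < eta -> ex_derive t s) ->
  (forall x y z w, Rabs (x - s0) < eta -> Rabs (y - s0) < eta ->
    Rabs (z - s0) < eta -> Rabs (w - s0) < eta -> y < x -> w < z ->
    defect g c x y = defect g c z w -> t x - t y = t z - t w) ->
  Rabs (a - s0) < eta -> Rabs (b - s0) < eta ->
  dot (covector g c t a) (c b) = dot (covector g c t b) (c a).
Proof.
  intros A Dt Ht Ha Hb. destruct (Rtotal_order a b) as [H|[->|H]].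
  - symmetry. now apply (covector_symmetric_lt g c t s0 eta d).
  - reflexivity.
  - now apply (covector_symmetric_lt g c t s0 eta d).
Qed.

(** Expanding [m s] in the basis dual to three points of the curve shows that
    [m s] is a linear function of [c s]. *)
Lemma symmetric_pairing_conic (I : R -> Prop) (c m : R -> vec) (b1 b2 b3 x y : R) :
  (forall s u, I s -> I u -> dot (m s) (c u) = dot (m u) (c s)) ->
  (forall s, I s -> dot (m s) (c s) = 0) ->
  I b1 -> I b2 -> I b3 -> dot (cross (c b1) (c b2)) (c b3) <> 0 ->
  I x -> I y -> dot (m x) (c y) <> 0 ->
  exists C : mat, symmetric C /\ C <> Mzero /\ forall s, I s -> form C (c s) (c s) = 0.
Proof.
  intros Hsym Hdiag H1 H2 H3 Hdet Hx Hy Hxy.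
  set (D := dot (cross (c b1) (c b2)) (c b3)) in *.
  (* The vectors c(b2) × c(b3) / D and its cyclic analogues form the dual basis. The coordinates of
     m(s) in it are <m(s), c(bi)>, which by symmetry equal <m(bi), c(s)> and so are linear in
     c(s). *)
  set (L := fun v : vec => plus (scal (dot (m b1) v / D) (cross (c b2) (c b3)))
    (plus (scal (dot (m b2) v / D) (cross (c b3) (c b1)))
      (scal (dot (m b3) v / D) (cross (c b1) (c b2))))).
  assert (HL : forall s, I s -> L (c s) = m s).
  { intros s Hs. unfold L.
    rewrite (Hsym b1 s), (Hsym b2 s), (Hsym b3 s) by assumption.
    apply vec_ext. intros i. rewrite !coord_plus, !coord_scal.
    field_simplify_eq; [|exact Hdet]. unfold D.
    destruct i as [|[|i]]; vec_ring. }
  set (k := fun i j => (coord (m b1) j * coord (cross (c b2) (c b3)) i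
    + coord (m b2) j * coord (cross (c b3) (c b1)) i
    + coord (m b3) j * coord (cross (c b1) (c b2)) i) / D).
  (* Adding the transpose makes symmetry hold by construction; on the curve it only doubles the
     quadratic form. *)
  set (C := mk_matrix 3 3 (fun i j => k i j + k j i)).
  assert (HC : forall u v, form C u v = dot (L u) v + dot (L v) u).
  { intros u v. unfold C. rewrite form_mk_matrix. unfold L, k.
    unfold Rdiv. generalize (/ D). intros z. vec_ring. }
  exists C. split; [|split].
  - intros i j Hi Hj. unfold C. rewrite !coeff_mat_bij by assumption. ring.
  (* Off the diagonal the form takes the value 2 <m(x), c(y)>, so C = 0 would contradict the assumed
     nonzero pairing. *)
  - intros H0. apply Hxy.
    assert (E : form C (c x) (c y) = 0).
    { rewrite H0. unfold Mzero. rewrite form_mk_matrix. vec_ring. }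
    rewrite HC, !HL, (Hsym y x) in E by assumption. lra.
  - intros s Hs. rewrite HC, HL, Hdiag by assumption. ring.
Qed.

(** If the determinant vanished for every x, so would its derivative at x = b, which is <c(a),
    n(b)>; but c(a) lies strictly on one side of the tangent at b. *)
Lemma exists_independent_points (g : geometry) (c : R -> vec) (s0 eta d a b : R) :
  regular_arc g c s0 eta d -> Rabs (a - s0) < eta -> Rabs (b - s0) < eta -> a <> b ->
  exists x, Rabs (x - s0) < eta /\ dot (cross (c b) (c x)) (c a) <> 0.
Proof.
  intros A Ha Hb Hab. apply NNPP. intros Hn.
  destruct (tangent_ratio_bounds g c s0 eta d a b A Ha Hb Hab) as (H & _).
  assert (Dx : is_derive (fun x => dot (cross (c b) (c x)) (c a)) b
    (dot (c a) (normal c b))).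
  { eapply is_derive_value.
    - apply is_derive_dot; [|apply is_vderive_const].
      apply is_vderive_cross; [apply is_vderive_const|].
      now apply (arc_derive g c s0 eta d).
    - unfold normal. vec_ring. }
  apply is_derive_unique in Dx.
  rewrite (Derive_ext_loc _ (fun _ => 0)), Derive_const in Dx.
  - rewrite <- Dx in H. lra.
  - apply (locally_of_radius s0 eta); [assumption|]. intros x Hx.
    apply NNPP. intros H0. apply Hn. now exists x.
Qed.

Theorem theorem1p7 (g : geometry) (c : R -> vec) (s0 : R)
  (hc : C2_curve_germ g c s0)
  (hcurv : geodesic_curvature g c s0 <> 0)
  (hP : string_Poritsky g c s0) :
  exists C : mat,
    symmetric C /\ C <> Mzero /\ locally s0 (fun s => conic g C (c s)).
Proof.
  destruct hP as (t & Ht & Ht0 & delta & HP).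
  destruct Ht as [r Hr].
  (* Serves both the Poritsky property, valid within delta, and the differentiability of t, valid
     within r. *)
  set (delta' := mkposreal _ (Rmin_stable_in_posreal delta r)).
  destruct (exists_regular_arc g c s0 delta' hc hcurv)
    as (eta & d & [He Hed] & A & Hsp & Hball).
  assert (Hd1 : delta' <= delta) by apply Rmin_l.
  assert (Hd2 : delta' <= r) by apply Rmin_r.
  assert (Dt : forall s, Rabs (s - s0) < eta -> ex_derive t s).
  { intros s Hs. apply (proj1 (Hr s ltac:(change (Rabs (s - s0) < r); lra)) 1%nat). lia. }
  assert (Hlev : forall x y z w, Rabs (x - s0) < eta -> Rabs (y - s0) < eta ->
    Rabs (z - s0) < eta -> Rabs (w - s0) < eta -> y < x -> w < z ->
    defect g c x y = defect g c z w -> t x - t y = t z - t w).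
  { intros x y z w Hx Hy Hz Hw Hyx Hwz E.
    (* Every defect on the arc lies strictly between 0 and delta', so it is an admissible p and its
       constant is common to all pairs of that level. *)
    pose proof (defect_bounds g c s0 eta d x y delta' A Hx Hy Hyx Hsp) as Hp.
    destruct (HP (defect g c x y) ltac:(lra)) as (cp & _ & Hcp).
    assert (Hpair : forall u v, Rabs (u - s0) < eta -> Rabs (v - s0) < eta -> v < u ->
      defect g c u v = defect g c x y -> t u - t v = cp).
    { intros u v Hu Hv Hvu Euv.
      assert (Huv : u <> v) by lra. pose proof (not_eq_sym Huv) as Hvu'.
      apply (Hcp u v (tangent_point g c u v)).
      - change (Rabs (u - s0) < delta). lra.
      - change (Rabs (v - s0) < delta). lra.
      - exact Hvu.
      - apply (ball_le (c s0) delta'); [exact Hd1|]. now apply Hball.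
      - split.
        + now apply (geodesic_tangent_point g c s0 eta d).
        + rewrite (tangent_point_comm g c s0 eta d) by assumption.
          now apply (geodesic_tangent_point g c s0 eta d).
      - rewrite <- Euv. now apply (string_defect_eq g c s0 eta d). }
    rewrite (Hpair x y), (Hpair z w); auto. }
  assert (Hs0 : Rabs (s0 - s0) < eta) by now rewrite Rminus_diag, Rabs_R0.
  set (a := s0 + eta / 2).
  assert (Ha : Rabs (a - s0) < eta)
    by (unfold a; rewrite Rabs_pos_eq; lra).
  assert (Has : a <> s0) by (unfold a; lra).
  destruct (exists_independent_points g c s0 eta d a s0 A Ha Hs0 Has) as (x & Hx & Hdet).
  destruct (symmetric_pairing_conic (fun s => Rabs (s - s0) < eta) c (covector g c t)
    s0 x a s0 a) as (C & HC1 & HC2 & HC3); try assumption.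
  - intros s u Hs Hu. now apply (covector_symmetric g c t s0 eta d).
  - intros s _. unfold covector, normal. vec_ring.
  (* The pairing <m(s0), c(a)> excludes the zero form: it is nonzero because t'(s0) is nonzero and
     c(a) lies off the tangent at s0. *)
  - destruct (tangent_ratio_bounds g c s0 eta d a s0 A Ha Hs0 Has) as (H & _).
    pose proof (speed_pos g c s0 eta d s0 A Hs0) as Hu.
    pose proof (frame_det_sign g c s0 eta d s0 A Hs0) as HD.
    unfold covector. replace (dot (scal _ _) _) with
      (Derive t s0 * speed g c s0 / frame_det c s0 * dot (c a) (normal c s0)) by vec_ring.
    assert (HDn : frame_det c s0 <> 0) by (intros H0; rewrite H0 in HD; lra).
    assert (Hn : dot (c a) (normal c s0) <> 0) by (intros H0; rewrite H0 in H; lra).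
    repeat apply Rmult_integral_contrapositive_currified; try assumption.
    + lra.
    + now apply Rinv_neq_0_compat.
  - exists C. split; [exact HC1|]. split; [exact HC2|].
    apply (locally_of_radius s0 eta); [exact Hs0|]. intros s Hs. split.
    + now apply (arc_Sigma g c s0 eta d).
    + now apply HC3.
Qed.
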